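(* Let $r$ be a positive integer. For any $r$-core $\gamma$ and any $m,n\in\mathbb{N}$, there is a bijection between the $m\times n$ matrices $A=(A_{i,j})_{0\le i<m,\,0\le j<n}$ with entries in $\{0,1\}^r$, and the pairs $(P,Q)$ consisting of a semistandard $r$-ribbon tableau $P$ (with $n$ steps) and a transpose semistandard $r$-ribbon tableau $Q$ (with $m$ steps) of equal shape $\lambda/\gamma$ for some partition $\lambda$, such that whenever $A$ corresponds to $(P,Q)$ one has $$\mathrm{wt}(P)=\Bigl(\sum_{i=0}^{m-1}|A_{i,j}|\Bigr)_{0\le j<n},\qquad \mathrm{wt}(Q)=\Bigl(\sum_{j=0}^{n-1}|A_{i,j}|\Bigr)_{0\le i<m},$$ and in addition $$\mathrm{spin}(P)+\mathrm{spin}^{\mathrm t}(Q)=\sum_{i=0}^{m-1}\sum_{j=0}^{n-1}\mathrm{n}(A_{i,j}).$$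
   Context: For $a=(a_0,\dots,a_{r-1})\in\{0,1\}^r$ put $|a|=\sum_{i=0}^{r-1}a_i$ and $\mathrm{n}(a)=\sum_{i=0}^{r-1}i\,a_i$. Partitions are identified with their Young diagrams (square $(i,j)$ in row $i$, column $j$, both numbered from $0$; rows numbered downwards). Diagonal $d_k$ is $\{(i,j):j-i=k\}$. For $\lambda\subset\mu$, $\mu/\lambda$ is an $r$-ribbon (written $\lambda\prec_r\mu$) if the skew diagram consists of exactly one square on each of $r$ consecutive diagonals; its head is its top-rightmost square, and its height is one less than the number of rows it meets. An $r$-core is a partition from which no $r$-ribbon can be removed. $\mu/\lambda$ is a horizontal (respectively vertical) $r$-ribbon strip, written $\lambda\leftharpoondown_r\mu$ (respectively $\lambda\leftharpoonup_r\mu$), if there is a (possibly trivial) chain $\lambda=\lambda^{(0)}\prec_r\cdots\prec_r\lambda^{(p)}=\mu$ such that, with $d_{k_t}$ the diagonal containing the head of $\lambda^{(t)}/\lambda^{(t-1)}$, one has $k_1<k_2<\cdots<k_p$ (respectively $k_1>k_2>\cdots>k_p$). Such a chain is unique and called the standardisation of $\mu/\lambda$ as a horizontal (respectively vertical) $r$-ribbon strip. In either case $|\mu/\lambda|_r=p$, and $\mathrm{spin}(\mu/\lambda)$ (respectively $\mathrm{spin}^{\mathrm t}(\mu/\lambda)$) is half the sum of the heights of the ribbons in that standardisation. A semistandard (respectively transpose semistandard) $r$-ribbon tableau of shape $\lambda/\gamma$ with $n$ steps is a sequence $\gamma=\lambda^0,\lambda^1,\dots,\lambda^n=\lambda$ with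 $\lambda^j\leftharpoondown_r\lambda^{j+1}$ (respectively $\lambda^j\leftharpoonup_r\lambda^{j+1}$) for $0\le j<n$ (repetitions allowed). Its weight $\mathrm{wt}$ is $(|\lambda^{j+1}/\lambda^j|_r)_{0\le j<n}$, and its $\mathrm{spin}$ (respectively $\mathrm{spin}^{\mathrm t}$) is the sum over $0\le j<n$ of $\mathrm{spin}(\lambda^{j+1}/\lambda^j)$ (respectively $\mathrm{spin}^{\mathrm t}(\lambda^{j+1}/\lambda^j)$). *)

(* Defs.v *)
From HB Require Import structures.
From mathcomp Require Import all_boot all_order all_algebra.
From mathcomp Require Import boolp classical_sets functions.

Set Implicit Arguments.
Unset Strict Implicit.
Unset Printing Implicit Defensive.

Import Order.TTheory GRing.Theory Num.Theory.

Record intpart := IntPart {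
  parts :> seq nat;
  partsP : sorted geq parts && (0 \notin parts)
}.
HB.instance Definition _ := [isSub for parts].
HB.instance Definition _ := [Choice of intpart by <:].

(* Squares are pairs (row, column), listed row by row from the top and from
   left to right in each row. *)
Definition diagram (la : intpart) : seq (nat * nat) :=
  [seq (i, j) | i <- iota 0 (size la), j <- iota 0 (nth 0 la i)].

Definition subdiagram (la mu : intpart) : Prop :=
  {subset diagram la <= diagram mu}.

Definition skew_squares (la mu : intpart) : seq (nat * nat) :=
  [seq s <- diagram mu | s \notin diagram la].

Definition diag (s : nat * nat) : int := (s.2%:Z - s.1%:Z)%R.

(* [perm_eq] compares multisets: one square on each of the diagonals
   k, ..., k + r - 1, and none on the others. *)
Definition ribbon (r : nat) (la mu : intpart) : Prop :=
  subdiagram la mu /\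
  exists k : int,
    perm_eq [seq diag s | s <- skew_squares la mu]
            [seq (k + i%:Z)%R | i <- iota 0 r].

(* The last square of the first nonempty row. *)
Definition ribbon_head (la mu : intpart) : nat * nat :=
  let sk := skew_squares la mu in
  last (0, 0) [seq s <- sk | s.1 == (head (0, 0) sk).1].

Definition head_diag (la mu : intpart) : int := diag (ribbon_head la mu).

Definition height (la mu : intpart) : nat :=
  (size (undup [seq s.1 | s <- skew_squares la mu])).-1.

Definition is_core (r : nat) (la : intpart) : Prop :=
  forall nu : intpart, ~ ribbon r nu la.

(* A chain la = la(0), la(1), ..., la(p) = mu is represented by la and the list
   c = [:: la(1); ...; la(p)]; the relation R is < for horizontal strips and
   > for vertical ones. *)
Definition standardisation (R : rel int) (r : nat) (la mu : intpart)
    (c : seq intpart) : Prop :=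
  [/\ path (fun x y => `[< ribbon r x y >]) la c,
      last la c = mu &
      sorted R (pairmap head_diag la c)].

Definition hstrip (r : nat) (la mu : intpart) : Prop :=
  exists c, standardisation <%R r la mu c.

Definition vstrip (r : nat) (la mu : intpart) : Prop :=
  exists c, standardisation >%R r la mu c.

(* The standardisation of a strip is unique, so [xget] makes no actual choice;
   the default [::] is only used when mu/la is not a strip. *)
Definition hstd (r : nat) (la mu : intpart) : seq intpart :=
  xget [::] [set c | standardisation <%R r la mu c].

Definition vstd (r : nat) (la mu : intpart) : seq intpart :=
  xget [::] [set c | standardisation >%R r la mu c].

Definition half_heights (la : intpart) (c : seq intpart) : rat :=
  ((sumn (pairmap height la c))%:R / 2%:R)%R.

Definition strip_spin (r : nat) (la mu : intpart) : rat :=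
  half_heights la (hstd r la mu).

Definition strip_spint (r : nat) (la mu : intpart) : rat :=
  half_heights la (vstd r la mu).

Section Tableaux.
Variables (r n : nat).
Implicit Types (T : n.+1.-tuple intpart) (j : 'I_n).

Definition lower T j : intpart := tnth T (widen_ord (leqnSn n) j).
Definition upper T j : intpart := tnth T (lift ord0 j).

Definition semistandard (ga la : intpart) T : Prop :=
  [/\ tnth T ord0 = ga, tnth T ord_max = la &
      forall j, hstrip r (lower T j) (upper T j)].

Definition transpose_semistandard (ga la : intpart) T : Prop :=
  [/\ tnth T ord0 = ga, tnth T ord_max = la &
      forall j, vstrip r (lower T j) (upper T j)].

Definition wt T : n.-tuple nat :=
  [tuple size (hstd r (lower T j) (upper T j)) | j < n].

Definition wtt T : n.-tuple nat :=
  [tuple size (vstd r (lower T j) (upper T j)) | j < n].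

Definition spin T : rat :=
  (\sum_(j < n) strip_spin r (lower T j) (upper T j))%R.

Definition spint T : rat :=
  (\sum_(j < n) strip_spint r (lower T j) (upper T j))%R.

End Tableaux.

Definition tableau_pairs (r : nat) (ga : intpart) (m n : nat) :
    set (n.+1.-tuple intpart * m.+1.-tuple intpart) :=
  [set PQ | exists la : intpart,
     semistandard r ga la PQ.1 /\ transpose_semistandard r ga la PQ.2].
Arguments tableau_pairs : clear implicits.

Definition weight (r : nat) (a : r.-tuple bool) : nat :=
  \sum_(i < r) tnth a i.

Definition nstat (r : nat) (a : r.-tuple bool) : nat :=
  \sum_(i < r) i * tnth a i.

(* Main.v *)
(** Record a partition by its Maya diagram on the integers: adding an r-ribbon
    with head on diagonal k moves a particle from k - r to k, and its height
    is the number of particles jumped over. Strips of both kinds then become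
    products, in increasing order of k, of operators U_k (add or not, weight x)
    and D_k (remove or not, weight y), with s marking heights. U_j and D_k
    commute for j <> k, while exchanging U_k and D_k costs a factor
    1 + s^(2c) x y, c being the number of particles strictly between k - r
    and k; these factors telescope to prod_(i < r) (1 + s^(2i) x y), which is
    the generating function of {0,1}^r. Comparing coefficients gives a
    weight-preserving bijection for one cell, and a growth diagram with
    constant border gamma assembles the cells; it can be run backwards since
    only the trivial strip ends at a core. *)

Require Import Defs.
From mathcomp Require Import all_boot all_order all_algebra.
From mathcomp Require Import boolp classical_sets functions.
From mathcomp Require Import zify ring.

Set Implicit Arguments.
Unset Strict Implicit.
Unset Printing Implicit Defensive.
Import Order.TTheory GRing.Theory Num.Theory.

(** * Profiles: the boundary of a partition read along the diagonals *)

Lemma count_iota_initial (P : pred nat) N :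
  (forall i j, i <= j -> P j -> P i) -> (forall i, N <= i -> ~~ P i) ->
  forall i, (i < count P (iota 0 N)) = P i.
Proof.
move=> Pdown PN.
have exM : exists M, ~~ P M by exists N; apply: PN.
have [M nPM minM] := ex_minnP exM.
have PE i : P i = (i < M).
  apply/idP/idP => [Pi|ltiM].
    by rewrite ltnNge; apply: contra nPM => leMi; apply: Pdown Pi.
  by apply: contraLR ltiM => nPi; rewrite -leqNgt minM.
have leMN : M <= N by apply/minM/PN.
have -> : count P (iota 0 N) = M; last by move=> i; rewrite PE.
rewrite -(subnKC leMN) iotaD count_cat add0n.
have /eqP-> : count P (iota 0 M) == size (iota 0 M).
  by rewrite -all_count; apply/allP => i; rewrite mem_iota PE.
rewrite size_iota (eq_in_count (a2 := pred0)) ?count_pred0 ?addn0 //.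
by move=> i; rewrite mem_iota PE /= => /andP[leMi _]; rewrite ltnNge leMi.
Qed.

Definition prow (la : intpart) i := nth 0 la i.

Lemma prow_le (la : intpart) i j : i <= j -> prow la j <= prow la i.
Proof.
move=> leij; rewrite /prow; have [ltj|] := ltnP j (size la); last by move/(nth_default 0)->.
have /andP[sla _] := partsP la.
have tr : transitive geq by move=> y x z /= h1 h2; apply: leq_trans h2 h1.
have re : reflexive geq by move=> x /=.
have := sorted_leq_nth tr re 0 sla; apply=> //; rewrite inE //.
exact: leq_ltn_trans ltj.
Qed.

(** This is the row of the first square of diagonal [d] outside the diagram. For [d < 0] the rows
    that the diagonal crosses left of column 0 are counted as well, so the counted rows always form
    an initial segment; none occurs from row [size la + |d|] on. *)
Definition prof (la : intpart) (d : int) : nat :=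
  count (fun i => (d < (prow la i)%:Z - i%:Z)%R) (iota 0 (size la + `|d|)).

Lemma lt_prof (la : intpart) (d : int) i : (i < prof la d) = (d < (prow la i)%:Z - i%:Z)%R.
Proof.
apply: count_iota_initial => [i' j leij|j lej].
  by have /= := prow_le la leij; lia.
by rewrite /prow nth_default; lia.
Qed.

Lemma prof_ge (la : intpart) (d : int) : (- d <= (prof la d)%:Z)%R.
Proof. by have := lt_prof la d (prof la d); rewrite ltnn; lia. Qed.

Lemma profS_le (la : intpart) (d : int) : prof la (d + 1)%R <= prof la d.
Proof.
rewrite leqNgt; apply/negP => H.
by move: (H); rewrite lt_prof; have := lt_prof la d (prof la d); rewrite ltnn; lia.
Qed.

Lemma prof_leS (la : intpart) (d : int) : prof la d <= (prof la (d + 1)%R).+1.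
Proof.
rewrite leqNgt; apply/negP => H.
move: (H); rewrite lt_prof.
have := lt_prof la (d + 1)%R (prof la (d + 1)%R); rewrite ltnn.
by have := prow_le la (leqnSn (prof la (d + 1)%R)); lia.
Qed.

Lemma prof_right (la : intpart) (d : int) : ((prow la 0)%:Z <= d)%R -> prof la d = 0.
Proof. by move=> H; apply/eqP; rewrite -leqn0 leqNgt lt_prof; lia. Qed.

Lemma prof_left (la : intpart) (d : int) : (d <= - (size la)%:Z)%R -> ((prof la d)%:Z = - d)%R.
Proof.
move=> H; have := prof_ge la d; have := lt_prof la d `|d|%N.
by rewrite /prow nth_default; lia.
Qed.

Lemma prow_inj (la mu : intpart) :
  (forall i, prow la i = prow mu i) -> la = mu.
Proof.
move=> E; apply: val_inj => /=.
have lesz (ka ta : intpart) : (forall i, prow ka i = prow ta i) ->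
    size ka <= size ta.
  move=> E'; rewrite leqNgt; apply/negP => lt.
  have /andP[_ /negP] := partsP ka; apply.
  have := E' (size ta); rewrite /prow (nth_default 0 (leqnn (size ta))) => <-.
  exact: mem_nth.
apply: (@eq_from_nth _ 0) => [|i _]; last exact: E.
by apply/eqP; rewrite eqn_leq !lesz.
Qed.

Lemma prof_inj : injective prof.
Proof.
move=> la mu E; apply: prow_inj => i.
have H d : (d < (prow la i)%:Z - i%:Z)%R = (d < (prow mu i)%:Z - i%:Z)%R.
  by rewrite -!lt_prof E.
have := H ((prow la i)%:Z - i%:Z)%R; have := H ((prow mu i)%:Z - i%:Z)%R.
by lia.
Qed.

Lemma intpart_of_prow (f : nat -> nat) M :
  (forall i, f i.+1 <= f i) -> f M = 0 ->
  exists la : intpart, forall i, prow la i = f i.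
Proof.
move=> fS fM.
have fle i j : i <= j -> f j <= f i.
  move/subnKC <-; elim: (j - i) => [|t IH]; first by rewrite addn0.
  by rewrite addnS; apply: leq_trans IH.
have exM : exists M, f M == 0 by exists M; apply/eqP.
have [N /eqP fN minN] := ex_minnP exM.
have P : sorted geq (mkseq f N) && (0 \notin mkseq f N).
  apply/andP; split.
    apply/(sortedP 0) => i; rewrite size_mkseq => lti.
    by rewrite !nth_mkseq ?(ltnW lti) //=; apply: fS.
  apply/mapP => -[i]; rewrite mem_iota /= add0n => lti /esym/eqP fi.
  by have := minN _ fi; rewrite leqNgt lti.
exists (IntPart P) => i; rewrite /prow /=.
have [lti|lei] := ltnP i N; first by rewrite nth_mkseq.
rewrite nth_default ?size_mkseq //; apply/esym/eqP.
by rewrite -leqn0 -fN fle.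
Qed.

(** These conditions characterise profiles, so ribbons can be added or removed by editing a profile.
    Row [i] of the partition is rebuilt as the least [t] with [g (t - i) <= i]. *)
Lemma prof_surj (g : int -> nat) :
  (forall d : int, g (d + 1)%R <= g d) -> (forall d : int, g d <= (g (d + 1)%R).+1) ->
  (exists N : nat, g (N%:Z)%R = 0) ->
  (exists N : nat, forall d : int, (d <= - N%:Z)%R -> ((g d)%:Z = - d)%R) ->
  exists la, prof la = g.
Proof.
move=> gS Sg [N gN] [M gM].
have gle d e : (d <= e)%R -> g e <= g d.
  move=> lede; have -> : e = (d + `|(e - d)%R|%N%:Z)%R by lia.
  elim: `|(e - d)%R|%N => [|t IH]; first by rewrite addr0.
  by rewrite (_ : (d + t.+1%:Z = d + t%:Z + 1)%R); [apply: leq_trans (gS _) IH | lia].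
have exf i : exists t : nat, g (t%:Z - i%:Z)%R <= i.
  by exists (N + i); rewrite (_ : ((N + i)%:Z - i%:Z = N%:Z)%R) ?gN //; lia.
pose f i := ex_minn (exf i).
have fP i d : (i < g d) = (d < (f i)%:Z - i%:Z)%R.
  rewrite /f; case: ex_minnP => t gt mint; apply/idP/idP => [|lt].
    rewrite ltNge ltnNge; apply: contra => le; apply: leq_trans gt.
    exact: gle.
  rewrite ltnNge; apply/negP => gd.
  have [d0|d0] := boolP (0 <= d + i%:Z)%R.
    have := mint `|(d + i%:Z)%R|%N.
    rewrite (_ : (`|(d + i%:Z)%R|%N%:Z - i%:Z = d)%R) ?gd; last by lia.
    by move=> /(_ isT); lia.
  (* Column [d + i] is negative here, so minimality of [f i] says nothing. The bound [- d <= g d] is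
     exact far to the left and is carried to [d] by [Sg]. *)
  have h1 : (- d <= (g d)%:Z)%R; last by lia.
  have [t' [ht h2]] : exists t' : nat, (d - t'%:Z <= - M%:Z)%R /\
      (- (d - t'%:Z) <= (g (d - t'%:Z))%:Z)%R.
    by exists (`|d|%N + M); split; [lia | rewrite gM; lia].
  clear - h2 Sg; elim: t' h2 => [|t' IH] h; first by rewrite subr0 in h.
  apply: IH; have := Sg (d - t'.+1%:Z)%R.
  by rewrite (_ : (d - t'.+1%:Z + 1 = d - t'%:Z)%R); lia.
have fS i : f i.+1 <= f i.
  rewrite leqNgt; apply/negP => H.
  have := fP i.+1 ((f i)%:Z - i%:Z - 1)%R; have := fP i ((f i)%:Z - i%:Z)%R.
  have := Sg ((f i)%:Z - i%:Z - 1)%R.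
  by rewrite (_ : ((f i)%:Z - i%:Z - 1 + 1 = (f i)%:Z - i%:Z)%R); lia.
have fM : f M = 0 by have := fP M (- M%:Z)%R; have := gM (- M%:Z)%R; lia.
have [la laE] := intpart_of_prow fS fM.
exists la; apply/funext => d.
have H i : (i < prof la d) = (i < g d) by rewrite lt_prof laE fP.
by have := H (prof la d); have := H (g d); rewrite !ltnn; lia.
Qed.

Lemma prof_le (la : intpart) (d e : int) : (d <= e)%R -> prof la e <= prof la d.
Proof.
move=> lede; have -> : e = (d + `|(e - d)%R|%N%:Z)%R by lia.
elim: `|(e - d)%R|%N => [|t IH]; first by rewrite addr0.
by rewrite (_ : (d + t.+1%:Z = d + t%:Z + 1)%R); [apply: leq_trans (profS_le _ _) IH | lia].
Qed.

(** Discrete intermediate values: a profile drops by at most one per diagonal. It serves to show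
    that a ribbon skips no row. *)
Lemma prof_ivt (la : intpart) (k : int) (t i : nat) :
  prof la k <= i -> i <= prof la (k - t%:Z)%R ->
  exists2 d : int, (k - t%:Z <= d <= k)%R & prof la d = i.
Proof.
elim: t => [|t IH] lei.
  by rewrite subr0 => gei; exists k; lia.
move=> gei; have [le|lt] := leqP i (prof la (k - t%:Z)%R).
  by have [d ? ?] := IH lei le; exists d => //; lia.
exists (k - t.+1%:Z)%R; first by lia.
have := prof_leS la (k - t.+1%:Z)%R.
by rewrite (_ : (k - t.+1%:Z + 1 = k - t%:Z)%R); lia.
Qed.

(** * Skew diagrams and ribbons in terms of profiles *)

Lemma mem_diagram (la : intpart) (s : nat * nat) :
  (s \in diagram la) = (s.1 < prof la (diag s)).
Proof.
rewrite lt_prof /diag /diagram; case: s => i j /=.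
apply/allpairsPdep/idP => /= [[i' [j' []]]|lt].
  rewrite !mem_iota => h1 h2 [-> ->]; rewrite /prow; lia.
exists i, j; rewrite !mem_iota; split=> //; last by move: lt; rewrite /prow; lia.
have [//|lei] := ltnP i (size la).
by move: lt; rewrite /prow nth_default //; lia.
Qed.

Lemma mem_skew (la mu : intpart) (s : nat * nat) :
  (s \in skew_squares la mu) = (prof la (diag s) <= s.1 < prof mu (diag s)).
Proof. by rewrite mem_filter !mem_diagram -leqNgt. Qed.

Lemma diagram_uniq (la : intpart) : uniq (diagram la).
Proof.
apply: allpairs_uniq_dep; first exact: iota_uniq.
  by move=> i _; apply: iota_uniq.
by move=> [i j] [i' j'] _ _ /= [-> ->].
Qed.

Lemma count_diag (la mu : intpart) (d : int) :
  count_mem d [seq diag s | s <- skew_squares la mu] = prof mu d - prof la d.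
Proof.
rewrite count_map -size_filter.
(* The column [i + d] is not negative for the rows used, because [i >= prof la d >= - d]; the
   absolute value is only a cast. *)
pose sq i := (i, `|(i%:Z + d)%R|%N) : nat * nat.
rewrite (_ : prof mu d - prof la d
  = size [seq sq i | i <- iota (prof la d) (prof mu d - prof la d)]); last first.
  by rewrite size_map size_iota.
apply/perm_size/uniq_perm.
- by rewrite !filter_uniq ?diagram_uniq.
- by rewrite map_inj_uniq ?iota_uniq // => i i' [->].
move=> [i j]; rewrite mem_filter mem_skew /=.
apply/andP/mapP => [[/eqP dE ij]|[i' h [-> ->]]].
  exists i; rewrite ?mem_iota -?dE /sq; first by lia.
  by congr pair; move: dE; rewrite /diag /=; lia.
have gd := prof_ge la d; move: h; rewrite mem_iota => h.
rewrite (_ : diag (i', `|(i'%:Z + d)%R|%N) = d) ?eqxx; first by lia.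
by rewrite /diag /=; lia.
Qed.

Lemma subdiagramP (la mu : intpart) :
  subdiagram la mu <-> forall d, prof la d <= prof mu d.
Proof.
split=> [sub d|le s]; last by rewrite !mem_diagram => /leq_trans; apply.
rewrite leqNgt; apply/negP => lt.
have gd := prof_ge mu d.
(* The first square of diagonal [d] outside [mu] would belong to [la]. *)
have dE : diag (prof mu d, `|((prof mu d)%:Z + d)%R|%N) = d by rewrite /diag /=; lia.
have := sub (prof mu d, `|((prof mu d)%:Z + d)%R|%N).
by rewrite !mem_diagram dE /= ltnn => /(_ lt).
Qed.

(** The index [k] is the diagonal of the head, while the one quantified in [ribbon] is the lowest
    diagonal; they differ by [r - 1]. *)
Definition is_ribbon (r : nat) (k : int) (la mu : intpart) :=
  forall d : int, prof mu d = prof la d + (k - r%:Z < d <= k)%R.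

Lemma count_mem_segment (r : nat) (k d : int) :
  count_mem d [seq (k + i%:Z)%R | i <- iota 0 r] = (k <= d < k + r%:Z)%R.
Proof.
rewrite count_uniq_mem; last by rewrite map_inj_uniq ?iota_uniq // => i i'; lia.
congr nat_of_bool; apply/mapP/idP => [[i] | lt].
  by rewrite mem_iota; lia.
by exists `|(d - k)%R|%N; rewrite ?mem_iota; lia.
Qed.

Lemma ribbonP (r : nat) (la mu : intpart) :
  ribbon r la mu <-> exists k, is_ribbon r k la mu.
Proof.
split=> [[/subdiagramP sub [k /permP E]]|[k R]].
  exists (k + r%:Z - 1)%R => d; have := E (pred1 d).
  by rewrite count_diag count_mem_segment; have := sub d; lia.
split; first by apply/subdiagramP => d; rewrite R leq_addr.
exists (k - r%:Z + 1)%R; apply/allP => d _ /=.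
by rewrite count_diag count_mem_segment R; apply/eqP; lia.
Qed.

(** The order in which [diagram] lists squares, needed to interpret [head] and [last] in
    [ribbon_head]. *)
Definition lexlt (s t : nat * nat) :=
  (s.1 < t.1) || (s.1 == t.1) && (s.2 < t.2).

Lemma diagram_lex (la : intpart) : pairwise lexlt (diagram la).
Proof.
suff: forall n a, pairwise lexlt
  [seq (i, j) | i <- iota a n, j <- iota 0 (nth 0 la i)] by apply.
elim=> [|n IH] a //=.
rewrite pairwise_cat IH andbT; apply/andP; split.
  apply/allrelP => s t /mapP[j _ ->] /allpairsPdep[i' [j' [+ _ ->]]].
  by rewrite mem_iota /lexlt /=; lia.
rewrite pairwise_map; apply: sub_pairwise (_ : pairwise ltn _) => [j j' /=|].
  by rewrite /lexlt /= eqxx => ->; rewrite orbT.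
by rewrite -sorted_pairwise ?iota_ltn_sorted //; apply: ltn_trans.
Qed.

Lemma skew_lex (la mu : intpart) : pairwise lexlt (skew_squares la mu).
Proof. exact: pairwise_filter (diagram_lex mu). Qed.

Lemma pairwise_last (T : eqType) (e : rel T) (x0 x : T) (s : seq T) :
  pairwise e s -> x \in s -> (x == last x0 s) || e x (last x0 s).
Proof.
case: (lastP s) => // s' y; rewrite -cats1 pairwise_cat last_cat /=.
case/and3P=> /allrelP h _ _; rewrite mem_cat inE => /orP[xs|->//].
by rewrite h ?orbT // inE.
Qed.

Section Ribbon.
Variables (r : nat) (k : int) (la mu : intpart).
Hypotheses (r_gt0 : 0 < r) (R : is_ribbon r k la mu).

Lemma mem_ribbon (s : nat * nat) : (s \in skew_squares la mu) =
  (k - r%:Z < diag s <= k)%R && (s.1 == prof la (diag s)).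
Proof. by rewrite mem_skew R; lia. Qed.

Let hd := (prof la k, `|((prof la k)%:Z + k)%R|%N).

Let diag_hd : diag hd = k.
Proof. by have := prof_ge la k; rewrite /diag /=; lia. Qed.

Let hd_skew : hd \in skew_squares la mu.
Proof. by rewrite mem_ribbon diag_hd /= eqxx; lia. Qed.

(** The square of the ribbon on diagonal [d] lies in row [prof la d], which weakly decreases with
    [d]. Hence the square on diagonal [k] is in the top row, and it is the last one there. *)
Lemma head_diag_ribbon : head_diag la mu = k.
Proof.
rewrite /head_diag /ribbon_head.
have Hrow s : s \in skew_squares la mu -> (diag s <= k)%R /\ prof la k <= s.1.
  by rewrite mem_ribbon => /andP[h1 /eqP ->]; have := prof_le la (_ : diag s <= k)%R; lia.
have pw := skew_lex la mu.
have hE : (head (0, 0) (skew_squares la mu)).1 = prof la k.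
  have h0 : head (0, 0) (skew_squares la mu) \in skew_squares la mu.
    by move: hd_skew; case: skew_squares => // s0 sk _; rewrite mem_head.
  have [_ h1] := Hrow _ h0; apply/eqP; rewrite eqn_leq h1 andbT.
  move: hd_skew pw; case: skew_squares => //= s0 sk.
  rewrite inE => /orP[/eqP <- //|hs /andP[/allP/(_ _ hs)]].
  by rewrite /lexlt /=; lia.
rewrite hE; set F := filter _ _.
have hF : hd \in F by rewrite mem_filter /= eqxx.
have pF : pairwise lexlt F by apply: pairwise_filter.
have := pairwise_last (0, 0) pF hF.
have : last (0, 0) F \in F by case: (F) hF => // s0 s _; rewrite /= mem_last.
rewrite mem_filter => /andP[/eqP l1 /Hrow[l2 _]] l3.
have : (k <= diag (last (0%N, 0%N) F))%R; last by lia.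
rewrite -{1}diag_hd; case/orP: l3 => [/eqP <- //|].
by rewrite /lexlt /diag l1 /=; lia.
Qed.

(** The rows met are the values of [prof la] on the diagonals of the ribbon; by [prof_ivt] they fill
    the whole interval between the two extreme values. *)
Lemma height_ribbon : height la mu = prof la (k - r%:Z + 1)%R - prof la k.
Proof.
have le : prof la k <= prof la (k - r%:Z + 1)%R by apply: prof_le; lia.
rewrite /height; set n := (_ - _).
rewrite -[RHS]/(n.+1.-1) -(size_iota (prof la k) n.+1); congr predn.
apply: perm_size; apply: uniq_perm; rewrite ?undup_uniq ?iota_uniq // => i.
rewrite mem_undup mem_iota; apply/mapP/idP => [[s]|lei].
  rewrite mem_ribbon => /andP[h1 /eqP h2] ->; rewrite h2.
  have := prof_le la (_ : diag s <= k)%R.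
  by have := prof_le la (_ : k - r%:Z + 1 <= diag s)%R; lia.
have [||d h1 h2] := @prof_ivt la k r.-1 i; first by lia.
  by rewrite (_ : (k - r.-1%:Z = k - r%:Z + 1)%R); lia.
exists (i, `|(i%:Z + d)%R|%N) => //.
have := prof_ge la d; rewrite mem_ribbon.
have -> : diag (i, `|(i%:Z + d)%R|%N) = d by have := prof_ge la d; rewrite /diag /=; lia.
by rewrite /= h2 eqxx; lia.
Qed.

End Ribbon.

(** * Maya diagrams and particle moves *)

(** Particles sit at the descents of the profile, that is, at the positions [prow la i - i - 1]. *)
Definition maya (la : intpart) (d : int) : bool := prof la (d + 1)%R < prof la d.

Definition npart (n : nat) (k : int) (m : int -> bool) : nat :=
  \sum_(1 <= i < n.+1) m (k - i%:Z)%R.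

Lemma npartS (n : nat) (k : int) (m : int -> bool) :
  npart n.+1 k m = npart n k m + m (k - n.+1%:Z)%R.
Proof. by rewrite /npart big_nat_recr. Qed.

Lemma prof_npart (la : intpart) (k : int) (n : nat) :
  prof la (k - n%:Z)%R = prof la k + npart n k (maya la).
Proof.
elim: n => [|n IH]; first by rewrite subr0 /npart big_geq ?addn0.
rewrite npartS addnA -IH /maya.
have := profS_le la (k - n.+1%:Z)%R; have := prof_leS la (k - n.+1%:Z)%R.
by rewrite (_ : (k - n.+1%:Z + 1 = k - n%:Z)%R); lia.
Qed.

Lemma maya_inj : injective maya.
Proof.
move=> la mu E; apply: prof_inj; apply/funext => d.
(* Both profiles vanish at [N], and going left from there they are counts of the same particles. *)
pose N := (Num.max (Num.max (prow la 0)%:Z (prow mu 0)%:Z) d)%R.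
have -> : (d = N - `|(N - d)%R|%N%:Z)%R by lia.
by rewrite !prof_npart E !prof_right //; lia.
Qed.

Lemma maya_bounds (la : intpart) : exists N : nat,
  (forall d : int, (d < - N%:Z)%R -> maya la d) /\
  (forall d : int, (N%:Z <= d)%R -> ~~ maya la d).
Proof.
exists (size la + prow la 0); split=> d hd; rewrite /maya.
  have := @prof_left la d; have := @prof_left la (d + 1)%R; lia.
by rewrite !prof_right; lia.
Qed.

Section Moves.
Variable r : nat.
Hypothesis r_gt0 : 0 < r.
Implicit Types (m : int -> bool) (k d : int) (b : bool) (S : seq int).

Definition swp k m d : bool :=
  if d == (k - r%:Z)%R then m k else if d == k then m (k - r%:Z)%R else m d.

(* A particle can jump from position [k - r] to [k] if [b], and from [k] to
   [k - r] otherwise. *)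
Definition can b k m : bool := (m (k - r%:Z)%R == b) && (m k == ~~ b).

Lemma swpK k : involutive (swp k).
Proof.
move=> m; apply/funext => d; rewrite /swp !eqxx.
have -> : (k == k - r%:Z :> int)%R = false by lia.
by case: eqP => [->//|_]; case: eqP => [->|].
Qed.

Lemma can_swp b k m : can b k m -> can (~~ b) k (swp k m).
Proof.
rewrite /can /swp !eqxx (_ : (k == k - r%:Z :> int)%R = false); last by lia.
by case/andP=> /eqP -> /eqP ->; rewrite negbK !eqxx.
Qed.

Lemma npart_swp k m : npart r.-1 k (swp k m) = npart r.-1 k m.
Proof.
apply: eq_big_nat => i /andP[i1 ir]; rewrite /swp.
by rewrite ifF ?ifF //; lia.
Qed.

(** A ribbon raises the profile by one on an interval, so descents change only at its two ends. As
    the steps of both profiles are 0 or 1, the particle must be at [k - r] before and at [k]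
    after. *)
Lemma maya_ribbon k la mu : is_ribbon r k la mu ->
  can true k (maya la) /\ maya mu = swp k (maya la).
Proof.
move=> R.
have a1 := R (k - r%:Z)%R; have a2 := R (k - r%:Z + 1)%R.
have a3 := R k; have a4 := R (k + 1)%R.
have b1 := profS_le la (k - r%:Z)%R; have b2 := prof_leS la (k - r%:Z)%R.
have b3 := profS_le mu (k - r%:Z)%R; have b4 := prof_leS mu (k - r%:Z)%R.
have b5 := profS_le la k; have b6 := prof_leS la k.
have b7 := profS_le mu k; have b8 := prof_leS mu k.
split; first by rewrite /can /maya; lia.
apply/funext => d; rewrite /swp; case: eqP => [->|h1]; first by rewrite /maya; lia.
case: eqP => [->|h2]; first by rewrite /maya; lia.
by rewrite /maya !R; lia.
Qed.

Lemma add_ribbon k la : can true k (maya la) -> exists mu, is_ribbon r k la mu.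
Proof.
rewrite /can /maya => h.
have [||||mu E] := @prof_surj (fun d => prof la d + (k - r%:Z < d <= k)%R).
- move=> d /=; have := profS_le la d; have := prof_leS la d.
  have [->|h1] := eqVneq d k; first by lia.
  have [->|h2] := eqVneq d (k - r%:Z)%R; first by lia.
  by lia.
- move=> d /=; have := profS_le la d; have := prof_leS la d.
  have [->|h1] := eqVneq d k; first by lia.
  have [->|h2] := eqVneq d (k - r%:Z)%R; first by lia.
  by lia.
- by exists (prow la 0 + `|k| + 1); rewrite prof_right; lia.
- exists (size la + `|k| + r) => d hd.
  by have := @prof_left la d; lia.
by exists mu => d; rewrite E.
Qed.

Lemma rem_ribbon k mu : can false k (maya mu) -> exists la, is_ribbon r k la mu.
Proof.
rewrite /can /maya => h.
(* A particle at [k] makes the profile positive up to [k], so the truncated subtraction below is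
   exact. *)
have pos d : (k - r%:Z < d <= k)%R -> 0 < prof mu d.
  by move=> hd; have := prof_le mu (_ : d <= k)%R; lia.
have [||||la E] := @prof_surj (fun d => prof mu d - (k - r%:Z < d <= k)%R).
- move=> d /=; have := profS_le mu d; have := prof_leS mu d.
  have := pos d; have := pos (d + 1)%R.
  have [->|h1] := eqVneq d k; first by lia.
  have [->|h2] := eqVneq d (k - r%:Z)%R; first by lia.
  by lia.
- move=> d /=; have := profS_le mu d; have := prof_leS mu d.
  have := pos d; have := pos (d + 1)%R.
  have [->|h1] := eqVneq d k; first by lia.
  have [->|h2] := eqVneq d (k - r%:Z)%R; first by lia.
  by lia.
- by exists (prow mu 0 + `|k| + 1); rewrite prof_right; lia.
- exists (size mu + `|k| + r) => d hd.
  by have := @prof_left mu d; lia.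
by exists la => d; rewrite E; have := pos d; lia.
Qed.

Lemma height_npart k la mu : is_ribbon r k la mu ->
  height la mu = npart r.-1 k (maya la).
Proof.
move=> R; rewrite (height_ribbon r_gt0 R).
have := prof_npart la k r.-1.
by rewrite (_ : (k - r.-1%:Z = k - r%:Z + 1)%R); lia.
Qed.

Fixpoint valid b S m : bool :=
  if S is k :: S' then can b k m && valid b S' (swp k m) else true.

Definition run S m := foldl (fun m' k => swp k m') m S.

Fixpoint hts S m : nat :=
  if S is k :: S' then npart r.-1 k m + hts S' (swp k m) else 0.

Lemma valid_rcons b S k m :
  valid b (rcons S k) m = valid b S m && can b k (run S m).
Proof. by elim: S m => [|k' S IH] m /=; rewrite ?andbT // IH andbA. Qed.

Lemma hts_rcons S k m : hts (rcons S k) m = hts S m + npart r.-1 k (run S m).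
Proof. by elim: S m => [|k' S IH] m /=; rewrite ?addn0 // IH addnA. Qed.

Lemma run_rcons S k m : run (rcons S k) m = swp k (run S m).
Proof. by rewrite /run foldl_rcons. Qed.

Lemma rev_moves b S m : valid b S m ->
  [/\ valid (~~ b) (rev S) (run S m), run (rev S) (run S m) = m &
      hts (rev S) (run S m) = hts S m].
Proof.
elim: S m => [|k S IH] m //= /andP[c /IH[h1 h2 h3]].
rewrite rev_cons valid_rcons run_rcons hts_rcons /= h1 h2 h3 swpK npart_swp.
by rewrite can_swp // addnC.
Qed.

Lemma chain_moves la (c : seq intpart) : path (fun x y => `[< ribbon r x y >]) la c ->
  [/\ valid true (pairmap head_diag la c) (maya la),
      run (pairmap head_diag la c) (maya la) = maya (last la c) &
      hts (pairmap head_diag la c) (maya la) = sumn (pairmap height la c)].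
Proof.
elim: c la => [|mu c IH] la //= /andP[/asboolP/ribbonP[k R] /IH[h1 h2 h3]].
have [h4 h5] := maya_ribbon R.
by rewrite (head_diag_ribbon r_gt0 R) (height_npart R) /run /= h4 -h5 h1 h3.
Qed.

Lemma moves_chain la S : valid true S (maya la) ->
  exists2 c : seq intpart, path (fun x y => `[< ribbon r x y >]) la c &
    pairmap head_diag la c = S.
Proof.
elim: S la => [|k S IH] la /=; first by exists [::].
case/andP=> c; have [mu R] := add_ribbon c.
rewrite -(maya_ribbon R).2 => /IH[c' h1 h2].
exists (mu :: c') => /=; last by rewrite h2 (head_diag_ribbon r_gt0 R).
by rewrite h1 andbT; apply/asboolP/ribbonP; exists k.
Qed.

Lemma run_untouched S m d : d \notin S -> (d + r%:Z)%R \notin S -> run S m d = m d.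
Proof.
elim: S m => [|k S IH] m //=; rewrite !inE !negb_or => /andP[h1 h2] /andP[h3 h4].
by rewrite /run /= -/(run S _) IH // /swp !ifF //; lia.
Qed.

Lemma run_lt S k m d : path <%R k S -> (d <= k - r%:Z)%R -> run S m d = m d.
Proof.
rewrite (path_sortedE lt_trans) => /andP[/allP h _] hd.
by apply: run_untouched; apply/negP => /h; lia.
Qed.

(** Heads increase, so no earlier move touches position [k]: its content is still the original one
    when the move at [k] takes place. *)
Lemma valid_start b S m k : sorted <%R S -> valid b S m -> k \in S -> m k = ~~ b.
Proof.
elim: S m => [|k0 S IH] m //= pS /andP[/andP[_ /eqP h1] h2].
rewrite inE => /orP[/eqP-> //|hk].
rewrite -(IH _ (path_sorted pS) h2 hk) /swp !ifF //.
  by have /allP/(_ _ hk) /= := order_path_min lt_trans pS; lia.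
by have /allP/(_ _ hk) /= := order_path_min lt_trans pS; lia.
Qed.

(** Dually, no later move touches [k - r], which keeps the content left there by the move at [k]. *)
Lemma valid_end b S m k :
  sorted <%R S -> valid b S m -> k \in S -> run S m (k - r%:Z)%R = ~~ b.
Proof.
elim: S m => [|k0 S IH] m //= pS /andP[/andP[_ /eqP h1] h2].
rewrite inE => /orP[/eqP->|hk]; last exact: IH (path_sorted pS) h2 hk.
by rewrite /run /= -/(run S _) (run_lt _ pS) // /swp eqxx.
Qed.

Lemma valid_first b k S m : valid b (k :: S) m -> m (k - r%:Z)%R = b.
Proof. by case/andP=> /andP[/eqP]. Qed.

Lemma valid_last b S k m : valid b (rcons S k) m -> run (rcons S k) m k = b.
Proof.
rewrite valid_rcons run_rcons => /andP[_ /andP[/eqP h1 _]].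
by rewrite /swp eqxx ifF //; lia.
Qed.

(** This yields uniqueness of standardisations. If the first heads differ, the smaller one, [k],
    changes position [k - r], which the other sequence never touches; so the heads agree and
    induction applies. *)
Lemma moves_inj b S S' m : sorted <%R S -> sorted <%R S' ->
  valid b S m -> valid b S' m -> run S m = run S' m -> S = S'.
Proof.
elim: S S' m => [|k S IH] [|k' S'] m; first by [].
- move=> _ pS v v' E; have := valid_end pS v' (mem_head _ _).
  by rewrite -E [run _ _ _]/= (valid_first v'); case: (b).
- move=> pS _ v v' E; have := valid_end pS v (mem_head _ _).
  by rewrite E [run _ _ _]/= (valid_first v); case: (b).
move=> pS pS' v v' E.
have e1 := valid_end pS v (mem_head _ _).
have e2 := valid_end pS' v' (mem_head _ _).
have [kk'|kk'|kk'] := ltgtP k k'.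
- have := @run_untouched (k' :: S') m (k - r%:Z)%R.
  rewrite (valid_first v).
  have /allP h := order_path_min lt_trans pS'.
  have nin d : (d <= k)%R -> d \notin k' :: S'.
    by move=> dk; rewrite inE negb_or; apply/andP; split; [lia | apply/negP => /h /=; lia].
  rewrite !nin; [|lia|lia] => /(_ isT isT).
  by rewrite -E e1; case: (b).
- have := @run_untouched (k :: S) m (k' - r%:Z)%R.
  rewrite (valid_first v').
  have /allP h := order_path_min lt_trans pS.
  have nin d : (d <= k')%R -> d \notin k :: S.
    by move=> dk; rewrite inE negb_or; apply/andP; split; [lia | apply/negP => /h /=; lia].
  rewrite !nin; [|lia|lia] => /(_ isT isT).
  by rewrite E e2; case: (b).
rewrite -kk' in pS' v' E *; congr cons.
move: v v' => /andP[_ v] /andP[_ v'].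
exact: (IH _ _ (path_sorted pS) (path_sorted pS') v v' E).
Qed.

End Moves.

(** * Up and down operators and their commutation *)

Lemma swp_hi r k m : 0 < r -> swp r k m k = m (k - r%:Z)%R.
Proof. by move=> r_gt0; rewrite /swp eqxx ifF //; lia. Qed.

Lemma swp_lo r k m : swp r k m (k - r%:Z)%R = m k.
Proof. by rewrite /swp eqxx. Qed.

Lemma swp_out r k m d : d <> (k - r%:Z)%R -> d <> k -> swp r k m d = m d.
Proof. by move=> /eqP/negPf h1 /eqP/negPf h2; rewrite /swp h1 h2. Qed.

Lemma npart_update n (j p : int) (m m' : int -> bool) :
  (forall d : int, (j - n%:Z <= d < j)%R -> d <> p -> m' d = m d) ->
  npart n j m' + (j - n%:Z <= p < j)%R * m p =
  npart n j m + (j - n%:Z <= p < j)%R * m' p.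
Proof.
elim: n => [|n IH] h; first by rewrite /npart !big_geq // (_ : (_ <= p < _)%R = false) //; lia.
have h' (d : int) : (j - n%:Z <= d < j)%R -> d <> p -> m' d = m d.
  by move=> hd; apply: h; lia.
have := IH h'; rewrite !npartS.
have [pE|pN] := eqVneq p (j - n.+1%:Z)%R.
  rewrite -pE (_ : (j - n%:Z <= p < j)%R = false); last by lia.
  rewrite (_ : (p <= p < j)%R = true); last by lia.
  by lia.
rewrite (h (j - n.+1%:Z)%R); [|by lia|by move/esym/eqP; rewrite (negPf pN)].
rewrite (_ : (j - n.+1%:Z <= p < j)%R = (j - n%:Z <= p < j)%R); last by lia.
by lia.
Qed.

Fixpoint window (k : int) (n : nat) : seq int :=
  if n is n'.+1 then k :: window (k + 1)%R n' else [::].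

Lemma mem_window k n d : (d \in window k n) = (k <= d < k + n%:Z)%R.
Proof. by elim: n k => [|n IH] k /=; rewrite ?inE ?IH ?in_nil; lia. Qed.

Lemma window_sorted k n : sorted <%R (window k n).
Proof.
elim: n k => [|[|n] IH] k //=; have /= -> := IH (k + 1)%R.
by rewrite ltrDl.
Qed.

Fixpoint sublists (ks : seq int) : seq (seq int) :=
  if ks is k :: ks' then sublists ks' ++ map (cons k) (sublists ks')
  else [:: [::]].

Section Operators.
Variables (r : nat) (R : comNzRingType) (x y s : R).
Hypothesis r_gt0 : 0 < r.
Implicit Types (F : (int -> bool) -> R) (m : int -> bool) (k : int) (b : bool).

Local Notation z b := (if b then x else y).

(** Operators act on functions of the configuration, [F] being evaluated after the move. Thus the
    outermost operator is the move made first, and [op b k F m] sums over not moving and moving at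
    [k]. *)
Definition op b k F : (int -> bool) -> R := fun m =>
  (F m + (can r b k m)%:R * (z b * s ^+ npart r.-1 k m) * F (swp r k m))%R.

Lemma swpC j k m : j <> k -> j <> (k - r%:Z)%R -> k <> (j - r%:Z)%R ->
  swp r j (swp r k m) = swp r k (swp r j m).
Proof.
move=> h1 h2 h3; apply/funext => d.
have [->|d1] := eqVneq d j.
  by rewrite swp_hi // !(@swp_out r k) ?swp_hi //; lia.
have [->|d2] := eqVneq d (j - r%:Z)%R.
  by rewrite swp_lo // !(@swp_out r k) ?swp_lo //; lia.
have [->|d3] := eqVneq d k.
  by rewrite swp_hi // !(@swp_out r j) ?swp_hi //; lia.
have [->|d4] := eqVneq d (k - r%:Z)%R.
  by rewrite swp_lo // !(@swp_out r j) ?swp_lo //; lia.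
by rewrite !swp_out //; apply/eqP.
Qed.

Lemma can_swpC b j k m : j <> k -> j <> (k - r%:Z)%R -> k <> (j - r%:Z)%R ->
  can r b j (swp r k m) = can r b j m.
Proof. by move=> h1 h2 h3; rewrite /can !swp_out //; lia. Qed.

(** Each of the two moves changes the number of particles that the other jumps over by the same
    amount: [+1] or [0] if [j < k], [-1] or [0] if [k < j]. *)
Lemma npart_swpC j k m : j <> k -> j <> (k - r%:Z)%R -> k <> (j - r%:Z)%R ->
  can r true j m -> can r false k m ->
  npart r.-1 j (swp r k m) + npart r.-1 k m =
  npart r.-1 k (swp r j m) + npart r.-1 j m.
Proof.
move=> h1 h2 h3 /andP[/eqP mj' /eqP mj] /andP[/eqP mk' /eqP mk].
have [jk|kj|//] := ltgtP j k.
  have e1 : forall d : int, (j - r.-1%:Z <= d < j)%R -> d <> (k - r%:Z)%R ->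
      swp r k m d = m d by move=> d hd hk; rewrite swp_out //; lia.
  have e2 : forall d : int, (k - r.-1%:Z <= d < k)%R -> d <> j ->
      swp r j m d = m d by move=> d hd hk; rewrite swp_out //; lia.
  have := npart_update e1; have := npart_update e2.
  by rewrite swp_lo swp_hi // mj mk mj' mk'; lia.
have e1 : forall d : int, (j - r.-1%:Z <= d < j)%R -> d <> k ->
    swp r k m d = m d by move=> d hd hk; rewrite swp_out //; lia.
have e2 : forall d : int, (k - r.-1%:Z <= d < k)%R -> d <> (j - r%:Z)%R ->
    swp r j m d = m d by move=> d hd hk; rewrite swp_out //; lia.
have := npart_update e1; have := npart_update e2.
by rewrite swp_lo swp_hi // mj mk mj' mk'; lia.
Qed.

Lemma opC j k F : j <> k -> op true j (op false k F) = op false k (op true j F).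
Proof.
move=> jk; apply/funext => m; rewrite /op.
suff : ((can r true j m)%:R * (x * s ^+ npart r.-1 j m) *
    ((can r false k (swp r j m))%:R * (y * s ^+ npart r.-1 k (swp r j m)) *
      F (swp r k (swp r j m))) =
   (can r false k m)%:R * (y * s ^+ npart r.-1 k m) *
    ((can r true j (swp r k m))%:R * (x * s ^+ npart r.-1 j (swp r k m)) *
      F (swp r j (swp r k m))))%R.
  by move=> E; rewrite !mulrDr E; ring.
(* If the moves share a position, the one made first always blocks the other, so both products
   vanish. *)
have [jE|h2] := eqVneq j (k - r%:Z)%R.
  rewrite /can -!jE !(swp_hi _ _ r_gt0) jE swp_lo -jE.
  by case: (m j); case: (m k); case: (m (j - r%:Z)%R); rewrite /= ?(andbF, mulr0n, mul0r, mulr0).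
have [kE|h3] := eqVneq k (j - r%:Z)%R.
  rewrite /can -!kE !(swp_hi _ _ r_gt0) kE swp_lo -kE.
  by case: (m j); case: (m k); case: (m (k - r%:Z)%R); rewrite /= ?(andbF, mulr0n, mul0r, mulr0).
move/eqP in h2; move/eqP in h3; have kj : k <> j by apply: nesym.
rewrite swpC // !can_swpC //.
case c1: (can r true j m); last by rewrite !(mul0r, mulr0).
case c2: (can r false k m); last by rewrite !(mul0r, mulr0).
rewrite !mul1r !mulrA [(x * _ * y)%R]mulrAC [(y * _ * x)%R]mulrAC.
rewrite -![(_ * s ^+ _ * s ^+ _)%R]mulrA -!exprD [(y * x)%R]mulrC.
by rewrite [npart r.-1 k m + _]addnC npart_swpC // addnC.
Qed.

Definition phi (c : nat) : R := (\prod_(i < c) (1 + s ^+ (2 * i) * (x * y)))%R.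

Lemma can_swpN b k m : can r b k (swp r k m) = can r (~~ b) k m.
Proof. by rewrite /can swp_lo swp_hi // andbC negbK. Qed.

Lemma npart_r k m : npart r k m = npart r.-1 k m + m (k - r%:Z)%R.
Proof. by rewrite -{1 3}(prednK r_gt0) npartS. Qed.

Lemma npart_rS k m : npart r (k + 1)%R m = npart r.-1 k m + m k.
Proof.
rewrite /npart big_nat_recl; last by lia.
rewrite addnC (_ : (k + 1 - 1%N%:Z = k)%R); last by lia.
congr (_ + _); rewrite (prednK r_gt0); apply: eq_big_nat => i _; congr (nat_of_bool (m _)); lia.
Qed.

(** With [N] particles strictly between [k - r] and [k], the exchange factor is [phi N.+1 / phi N].
    Division is avoided by attaching [phi] of the [r] positions below [k] to one side and of those
    below [k + 1] to the other, so that identities for consecutive [k] chain together. *)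
Lemma op_exchange k F m :
  (phi (npart r k m) * op false k (op true k F) m =
   op true k (op false k (fun m' => phi (npart r (k + 1) m') * F m')) m)%R.
Proof.
rewrite /op !can_swpN /= swpK // npart_swp // !npart_rS npart_r npart_swp // swp_hi //.
have phiS n : (phi n.+1 = phi n * (1 + s ^+ (2 * n) * (x * y)))%R.
  by rewrite /phi big_ord_recr.
rewrite /can; set N := npart _ _ _.
have := phiS N; rewrite mulnC exprM.
case: (m (k - r%:Z)%R); case: (m k); rewrite /= ?addn0 ?addn1 => E; rewrite ?E; ring.
Qed.

Definition ops b (ks : seq int) F := foldr (op b) F ks.

Lemma op_ops b k ks F : k \notin ks ->
  ops b ks (op (~~ b) k F) = op (~~ b) k (ops b ks F).
Proof.
elim: ks => [|j ks IH] //=; rewrite inE negb_or => /andP[/eqP kj /IH ->].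
by case: b {IH} => /=; [rewrite -opC //; apply: nesym | rewrite opC].
Qed.

(** The up operator at [k] commutes past the down operators at larger heads, is exchanged with the
    down operator at [k], and the updated factor [phi] is passed on to the window starting at
    [k + 1]. *)
Lemma ops_exchange k n F m :
  (phi (npart r k m) * ops false (window k n) (ops true (window k n) F) m =
   ops true (window k n) (ops false (window k n)
     (fun m' => phi (npart r (k + n%:Z) m') * F m')) m)%R.
Proof.
elim: n k m => [|n IH] k m /=; first by rewrite addr0.
have knot : k \notin window (k + 1)%R n by rewrite mem_window; lia.
rewrite (@op_ops false) // op_exchange (@op_ops true) //.
congr (op true k (op false k _) m); apply/funext => m'.
by rewrite IH (_ : (k + 1 + n%:Z = k + n.+1%:Z)%R); last lia.
Qed.

Lemma ops_sum b ks F m : (ops b ks F m =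
  \sum_(S <- sublists ks | valid r b S m)
     z b ^+ size S * s ^+ hts r S m * F (run r S m))%R.
Proof.
elim: ks m => [|k ks IH] m; first by rewrite /= big_cons big_nil /= !expr0 !mul1r addr0.
rewrite [LHS]/= /op !IH /= big_cat big_map /=; congr (_ + _)%R.
case: (can r b k m) => /=; last by rewrite !mul0r big_pred0_eq.
rewrite mul1r big_distrr /=; apply: eq_bigr => S _.
by rewrite exprD exprS; ring.
Qed.

End Operators.

(** * Strips as increasing sequences of moves *)

Section Strips.
Variable r : nat.
Hypothesis r_gt0 : 0 < r.
Implicit Types la mu : intpart.

Definition hheads la mu := pairmap head_diag la (hstd r la mu).
(** A vertical strip is read backwards, as ribbons removed from [mu]; reversal makes the heads
    increase, as for horizontal strips. *)
Definition vheads la mu := rev (pairmap head_diag la (vstd r la mu)).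

Definition hht la mu := sumn (pairmap height la (hstd r la mu)).
Definition vht la mu := sumn (pairmap height la (vstd r la mu)).

Lemma valid_false_end S mu : valid r false S (maya mu) ->
  exists la, maya la = run r S (maya mu).
Proof.
elim: S mu => [|k S IH] mu /=; first by exists mu.
case/andP=> c; have [la R] := rem_ribbon r_gt0 c.
have -> : swp r k (maya mu) = maya la.
  by rewrite (maya_ribbon r_gt0 R).2 swpK.
exact: IH.
Qed.

Lemma valid_true_end S la : valid r true S (maya la) ->
  exists mu, maya mu = run r S (maya la).
Proof.
case/(moves_chain r_gt0)=> c /(chain_moves r_gt0)[_ + _] cS.
by rewrite cS => E; exists (last la c); rewrite E.
Qed.

Lemma hstd_spec la mu : hstrip r la mu ->
  [/\ sorted <%R (hheads la mu), valid r true (hheads la mu) (maya la),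
      run r (hheads la mu) (maya la) = maya mu &
      hht la mu = hts r (hheads la mu) (maya la)].
Proof.
move=> /(xgetPex [::])[p lE so].
by have [h1 h2 h3] := chain_moves r_gt0 p; split; rewrite // -[in RHS]lE.
Qed.

Lemma vstd_spec la mu : vstrip r la mu ->
  [/\ sorted <%R (vheads la mu), valid r false (vheads la mu) (maya mu),
      run r (vheads la mu) (maya mu) = maya la &
      vht la mu = hts r (vheads la mu) (maya mu)].
Proof.
move=> /(xgetPex [::])[p lE so].
have [/(rev_moves r_gt0)[v1 v2 v3] h2 h3] := chain_moves r_gt0 p.
rewrite h2 lE in v1 v2 v3; split=> //.
  by rewrite /vheads rev_sorted.
by rewrite /vht /vheads v3.
Qed.

(** Any valid increasing sequence of moves gives a standardisation, and by [moves_inj] the one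
    selected by [hstd] has the same heads. *)
Lemma hheads_unique la mu S : sorted <%R S -> valid r true S (maya la) ->
  run r S (maya la) = maya mu -> hstrip r la mu /\ hheads la mu = S.
Proof.
move=> so v rS; have [c p cS] := moves_chain r_gt0 v.
have H : hstrip r la mu.
  exists c; split=> //; last by rewrite cS.
  by apply: maya_inj; have [_ <- _] := chain_moves r_gt0 p; rewrite cS.
split=> //; have [h1 h2 h3 _] := hstd_spec H.
by apply: (moves_inj r_gt0 h1 so h2 v); rewrite h3.
Qed.

Lemma vheads_unique la mu S : sorted <%R S -> valid r false S (maya mu) ->
  run r S (maya mu) = maya la -> vstrip r la mu /\ vheads la mu = S.
Proof.
move=> so v rS; have [v1 v2 _] := rev_moves r_gt0 v.
rewrite rS in v1 v2; have [c p cS] := moves_chain r_gt0 v1.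
have H : vstrip r la mu.
  exists c; split=> //; last by rewrite cS rev_sorted.
  by apply: maya_inj; have [_ <- _] := chain_moves r_gt0 p; rewrite cS.
split=> //; have [h1 h2 h3 _] := vstd_spec H.
by apply: (moves_inj r_gt0 h1 so h2 v); rewrite h3.
Qed.

End Strips.

(** * From generating functions to weight-preserving bijections *)

Section Weights.

Let x : {poly {poly {poly int}}} := 'X%R.
Let y : {poly {poly {poly int}}} := ('X%:P)%R.
Let s : {poly {poly {poly int}}} := ('X%:P%:P)%R.

Definition mono (R : comNzRingType) (x y s : R) (w : nat * (nat * nat)) : R :=
  (x ^+ w.1 * y ^+ w.2.1 * s ^+ w.2.2)%R.

Lemma coef_mono v w :
  ((mono x y s w)`_(v.1)`_(v.2.1)`_(v.2.2) = (w == v)%:R :> int)%R.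
Proof.
case: v w => a [b c] [a' [b' c']]; rewrite /mono /x /y /s /=.
rewrite -!polyC_exp -mulrA -polyCM [(_ * _%:P)%R]mulrC coefCM coefXn.
rewrite !xpair_eqE [a' == a]eq_sym; case: eqP => _; last by rewrite mulr0 !coef0.
rewrite mulr1 mulrC coefCM coefXn [b' == b]eq_sym.
case: eqP => _; last by rewrite mulr0 !coef0.
by rewrite mulr1 coefXn eq_sym.
Qed.

(** Take for [x], [y], [s] the three indeterminates of an iterated polynomial ring over the
    integers: each coefficient is then the multiplicity of one weight. *)
Lemma perm_eq_of_mono (t u : seq (nat * (nat * nat))) :
  (forall (R : comNzRingType) (x y s : R),
    \sum_(w <- t) mono x y s w = \sum_(w <- u) mono x y s w)%R ->
  perm_eq t u.
Proof.
move=> E; apply/allP => v _ /=.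
have {E} := congr1 (fun p : {poly {poly {poly int}}} => p`_(v.1)`_(v.2.1)`_(v.2.2))%R (E _ x y s).
have C w : ((\sum_(w0 <- w) mono x y s w0)`_(v.1)`_(v.2.1)`_(v.2.2)
    = (count_mem v w)%:Z)%R.
  rewrite !coef_sum (eq_bigr (fun w0 => (w0 == v)%:R%R)) => [|w0 _]; last exact: coef_mono.
  elim: w => [|w0 w IH]; first by rewrite big_nil.
  by rewrite big_cons IH /= PoszD natz.
by rewrite !C => -[->].
Qed.

End Weights.

(** The sets are encoded injectively onto duplicate-free lists. A permutation of positions matching
    the two lists of weights is read back through the encodings; the element of [T2] is a default
    value. *)
Lemma bij_of_perm (T1 T2 : Type) (U1 U2 W : eqType) (A : set T1) (B : set T2)
    (e1 : T1 -> U1) (e2 : T2 -> U2) (L1 : seq U1) (L2 : seq U2)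
    (w1 : U1 -> W) (w2 : U2 -> W) :
  T2 -> uniq L1 -> uniq L2 -> perm_eq (map w1 L1) (map w2 L2) ->
  (forall a, A a -> e1 a \in L1) -> {in A &, injective e1} ->
  (forall u, u \in L1 -> exists2 a, A a & e1 a = u) ->
  (forall b, B b -> e2 b \in L2) -> {in B &, injective e2} ->
  (forall u, u \in L2 -> exists2 b, B b & e2 b = u) ->
  exists g, set_bij A B g /\ forall a, A a -> w2 (e2 (g a)) = w1 (e1 a).
Proof.
move=> b0 uL1 uL2 pe A1 A2 A3 B1 B2 B3.
(* If the second list is empty so is the first, hence [A] and [B]; otherwise [u0] supplies default
   values for [nth]. *)
case L2E : L2 => [|u0 L2'].
  have L1E : L1 = [::] by apply: size0nil; rewrite -(size_map w1) (perm_size pe) L2E.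
  have nA a : ~ A a by move=> /A1; rewrite L1E.
  exists (fun _ => b0); split=> [|a /nA//]; split=> [a /nA//|a b|b /B1].
    by rewrite inE => /nA.
  by rewrite L2E.
have h u : exists b, u \in L2 -> B b /\ e2 b = u.
  have [/B3[b Bb bu]|nu] := boolP (u \in L2); first by exists b.
  by exists b0.
have [e2' e2P] := choice h.
have w0 : W := w2 u0.
have /(perm_iotaP w0)[Is pI wE] := pe.
have sz : size L1 = size L2 by rewrite -(size_map w1) (perm_size pe) size_map.
have sI : size Is = size L2 by rewrite (perm_size pI) size_iota size_map.
have uI : uniq Is by rewrite (perm_uniq pI) iota_uniq.
have mI i : (i \in Is) = (i < size L2) by rewrite (perm_mem pI) mem_iota size_map.
pose g u := nth u0 L2 (nth 0 Is (index u L1)).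
have idx u : u \in L1 -> nth 0 Is (index u L1) < size L2.
  by move=> uL; rewrite -mI mem_nth // sI -sz index_mem.
have gL u : u \in L1 -> g u \in L2 by move=> uL; rewrite mem_nth ?idx.
have gw u : u \in L1 -> w2 (g u) = w1 u.
  move=> uL; have iu : index u L1 < size L1 by rewrite index_mem.
  rewrite /g -(nth_map u0 w0) ?idx // -{2}(nth_index u uL) -(nth_map u w0) // wE.
  by rewrite (nth_map 0) // sI -sz.
have ginj u v : u \in L1 -> v \in L1 -> g u = g v -> u = v.
  move=> uL vL /eqP; rewrite /g nth_uniq ?idx // nth_uniq ?sI -?sz ?index_mem //.
  by move=> /eqP/(congr1 (nth u L1)); rewrite !nth_index.
exists (fun a => e2' (g (e1 a))); split; last first.
  by move=> a /A1 aL; rewrite (e2P _ (gL _ aL)).2 gw.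
split=> [a /A1 aL|a b /set_mem Aa /set_mem Ab E|b Bb].
- exact: (e2P _ (gL _ aL)).1.
- have [aL bL] := (A1 _ Aa, A1 _ Ab).
  apply: A2; rewrite ?inE //; apply: ginj => //.
  by rewrite -(e2P _ (gL _ aL)).2 E (e2P _ (gL _ bL)).2.
have bL := B1 _ Bb; pose i := index (e2 b) L2.
have iI : i \in Is by rewrite mI index_mem.
have jL : index i Is < size L1 by rewrite sz -sI index_mem.
case L1E : (L1) jL => [|v0 L1'] // ; rewrite -L1E => jL.
have [a Aa aE] := A3 _ (mem_nth v0 jL).
have gE : g (e1 a) = e2 b.
  by rewrite /g aE index_uniq // nth_index // nth_index.
exists a => //; apply: B2; rewrite ?inE //.
  by rewrite gE; apply: (e2P _ bL).1.
by rewrite gE (e2P _ bL).2.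
Qed.

(** * Confining all moves to a finite window *)

Lemma mem_sublists (ks S : seq int) : (S \in sublists ks) = subseq S ks.
Proof.
elim: ks S => [|k ks IH] S; first by rewrite inE; case: S.
rewrite mem_cat IH; apply/orP/idP => [[h|/mapP[S']]|].
- exact: subseq_trans h (subseq_cons _ _).
- by rewrite IH => h -> /=; rewrite eqxx.
case: S => [|j S] /=; first by left; rewrite sub0seq.
case: eqP => [->|_] h; last by left.
by right; apply: map_f; rewrite IH.
Qed.

Lemma sublists_uniq (ks : seq int) : uniq ks -> uniq (sublists ks).
Proof.
elim: ks => [|k ks IH] //= /andP[nk /IH u].
rewrite cat_uniq u map_inj_uniq ?u ?andbT => [|S S' [->] //].
apply/hasPn => S /mapP[S' _ ->]; rewrite mem_sublists.
by apply: contra nk => /mem_subseq; apply; rewrite mem_head.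
Qed.

Lemma mem_sublists_window lo n (S : seq int) : (S \in sublists (window lo n)) =
  sorted <%R S && all (fun k => lo <= k < lo + n%:Z)%R S.
Proof.
rewrite mem_sublists; apply/idP/andP => [h|[so /allP h]].
  split; first exact: (subseq_sorted lt_trans h (window_sorted lo n)).
  by apply/allP => k /(mem_subseq h); rewrite mem_window.
suff -> : S = [seq k <- window lo n | k \in S] by apply: filter_subseq.
apply: (irr_sorted_eq lt_trans ltxx) => // [|k].
  by apply: sorted_filter; [apply: lt_trans | apply: window_sorted].
by rewrite mem_filter mem_window; case kS : (k \in S) => //=; rewrite h.
Qed.

Section Bounds.
Variables (r : nat) (lo hi : int) (m0 m1 : int -> bool).
Hypotheses (r_gt0 : 0 < r)
  (lo0 : forall d : int, (d < lo)%R -> m0 d) (hi0 : forall d : int, (hi <= d)%R -> ~~ m0 d)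
  (lo1 : forall d : int, (d < lo)%R -> m1 d) (hi1 : forall d : int, (hi <= d)%R -> ~~ m1 d).
Variables (S T : seq int).
Hypotheses (sS : sorted <%R S) (sT : sorted <%R T).

Let in_bounds := all (fun k => lo <= k < hi + r%:Z)%R.

Lemma sorted_ge_head (U : seq int) (k : int) : sorted <%R U ->
  k \in U -> exists j U', U = j :: U' /\ (j <= k)%R.
Proof.
case: U => //= j U pU; rewrite inE => /orP[/eqP->|kU]; exists j, U => //; split=> //.
by have /allP/(_ _ kU) := order_path_min lt_trans pU; apply: ltW.
Qed.

Lemma sorted_le_last (U : seq int) (k : int) : sorted <%R U ->
  k \in U -> exists j U', U = rcons U' j /\ (k <= j)%R.
Proof.
case/lastP: U => // U j sU kU; exists j, U; split=> //.
move: kU; rewrite mem_rcons inE => /orP[/eqP-> //|kU].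
move: sU; rewrite sorted_pairwise; last exact: lt_trans.
by rewrite -cats1 pairwise_cat => /and3P[/allrelP/(_ _ j kU)]; rewrite inE eqxx => /(_ isT)/ltW.
Qed.

(** An up move at [k] needs [k] empty in [m0], and a down move leaves [k - r] filled in [m1]. The
    other two bounds follow the particle at the last head of [S] and the hole required by the first
    head of [T]. *)
Lemma updown_bounds : valid r true S m0 -> valid r false T (run r S m0) ->
  run r T (run r S m0) = m1 -> in_bounds S && in_bounds T.
Proof.
move=> vS vT rT.
have loS k : k \in S -> (lo <= k)%R.
  move=> kS; rewrite leNgt; apply/negP => /lo0.
  by rewrite (valid_start r_gt0 sS vS kS).
have hiT k : k \in T -> (k - r%:Z < hi)%R.
  move=> kT; rewrite ltNge; apply/negP => /hi1.
  by rewrite -rT (valid_end r_gt0 sT vT kT).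
apply/andP; split; apply/allP => k kU; apply/andP; split; first exact: loS.
- have [j [S' [SE kj]]] := sorted_le_last sS kU; apply: le_lt_trans kj _.
  have lj : run r S m0 j by move: vS; rewrite SE; apply: valid_last.
  have [/hiT|jT] := boolP (j \in T); first by lia.
  have hj : m1 j -> (j < hi + r%:Z)%R.
    by move=> m1j; rewrite ltNge; apply/negP => h; have := hi1 (_ : hi <= j)%R; rewrite m1j; lia.
  apply: hj; rewrite -rT; have [jT'|jT'] := boolP ((j + r%:Z)%R \in T).
    by have := valid_end r_gt0 sT vT jT'; rewrite addrK => ->.
  by rewrite run_untouched.
- have [j [T' [TE kj]]] := sorted_ge_head sT kU; apply: le_trans kj.
  move: vT; rewrite {1}TE => /valid_first; rewrite leNgt => h; apply/negP => jlo.
  move: h; rewrite run_untouched //.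
  - by rewrite lo0 //; lia.
  - by apply/negP => /loS; lia.
  - by apply/negP => /loS; lia.
by have := hiT _ kU; lia.
Qed.

(** Here each bound comes from a single position: [m0] is inspected where the down moves begin, and
    [m1] where the up moves end. *)
Lemma downup_bounds : valid r false S m0 -> valid r true T (run r S m0) ->
  run r T (run r S m0) = m1 -> in_bounds S && in_bounds T.
Proof.
move=> vS vT rT.
apply/andP; split; apply/allP => k kU; apply/andP; split.
- have [j [S' [SE kj]]] := sorted_ge_head sS kU; apply: le_trans kj.
  move: vS; rewrite SE => /valid_first h; rewrite leNgt; apply/negP => jlo.
  by move: h; rewrite lo0 //; lia.
- rewrite ltNge; apply/negP => h; have := valid_start r_gt0 sS vS kU.
  by apply/negP; apply: hi0; lia.
- rewrite leNgt; apply/negP => h; have := valid_end r_gt0 sT vT kU.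
  by rewrite rT lo1 //; lia.
have [j [T' [TE kj]]] := sorted_le_last sT kU; apply: le_lt_trans kj _.
rewrite ltNge; apply/negP => h; move: vT; rewrite TE => /(valid_last r_gt0).
by rewrite -TE rT; apply/negP; apply: hi1; lia.
Qed.

End Bounds.

(** * The local rule for one cell *)

Section Cell.
Variable r : nat.
Hypothesis r_gt0 : 0 < r.

Definition moves2 b (ks : seq int) (m m' : int -> bool) : seq (seq int * seq int) :=
  [seq e <- [seq (U, V) | U <- sublists ks, V <- sublists ks] |
    [&& valid r b e.1 m, valid r (~~ b) e.2 (run r e.1 m) &
        `[< run r e.2 (run r e.1 m) = m' >]]].

Definition updown_weight m (e : seq int * seq int) :=
  (size e.1, (size e.2, hts r e.1 m + hts r e.2 (run r e.1 m))).

(** The vector stands for the term of [phi] in which factor [i] contributes [s ^+ (2 * i) * (x * y)]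
    exactly when its entry [i] is 1; hence its weight counts in both strips and [nstat] counts twice
    in the heights. *)
Definition downup_weight m (e : r.-tuple bool * (seq int * seq int)) :=
  (size e.2.2 + weight e.1,
    (size e.2.1 + weight e.1,
      hts r e.2.1 m + hts r e.2.2 (run r e.2.1 m) + 2 * nstat e.1)).

Lemma phi_sum (R : comNzRingType) (x y s : R) :
  (phi x y s r = \sum_(a : r.-tuple bool) mono x y s (weight a, (weight a, 2 * nstat a)%N))%R.
Proof.
rewrite /phi.
transitivity (\prod_(i < r) \sum_(b : bool) (s ^+ (2 * i) * (x * y)) ^+ b)%R.
  by apply: eq_bigr => i _; rewrite big_bool /= expr1 expr0 addrC.
rewrite bigA_distr_bigA /=.
rewrite (reindex (fun a : r.-tuple bool => [ffun i => tnth a i])) /=; last first.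
  exists (fun f : {ffun 'I_r -> bool} => [tuple f i | i < r]) => a _.
    by apply: eq_from_tnth => i; rewrite tnth_mktuple ffunE.
  by apply/ffunP => i; rewrite ffunE tnth_mktuple.
apply: eq_bigr => a _; rewrite /mono /= /weight /nstat big_distrr /=.
rewrite -!prodrXr -!big_split /=; apply: eq_bigr => i _.
by rewrite ffunE exprMn exprMn -exprM mulrC mulnA.
Qed.

Lemma ops_delta (R : comNzRingType) (x y s : R) b ks (m m' : int -> bool) :
  (ops r x y s b ks (ops r x y s (~~ b) ks (fun n => `[< n = m' >]%:R)) m =
   \sum_(e <- moves2 b ks m m')
     (if b then x else y) ^+ size e.1 * (if b then y else x) ^+ size e.2 *
     s ^+ (hts r e.1 m + hts r e.2 (run r e.1 m)))%R.
Proof.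
rewrite ops_sum /moves2 big_filter [RHS]big_mkcond [RHS]big_allpairs /=.
rewrite big_mkcond; apply: eq_bigr => S _ /=.
case: (valid r b S m) => /=; last by rewrite big1_eq.
rewrite ops_sum big_distrr big_mkcond /=; apply: eq_bigr => T _.
case: (valid _ _ T _) => //=; case: asboolP => _; last by rewrite !mulr0.
by rewrite exprD; case: b => /=; ring.
Qed.

Lemma cell_sum (R : comNzRingType) (x y s : R) lo n (m0 m1 : int -> bool) :
  npart r lo m0 = r -> npart r (lo + n%:Z)%R m1 = 0 ->
  (\sum_(w <- [seq downup_weight m0 e | e <- [seq (a, e) |
      a <- enum {: r.-tuple bool}, e <- moves2 false (window lo n) m0 m1]])
      mono x y s w =
   \sum_(w <- [seq updown_weight m0 e | e <- moves2 true (window lo n) m0 m1])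
      mono x y s w)%R.
Proof.
move=> p0 p1; have := ops_exchange x y s r_gt0 lo n (fun m => (`[< m = m1 >])%:R%R) m0.
(* All [r] positions below [lo] are filled in [m0], which gives [phi r]. Those below [lo + n] are
   empty in [m1], so under the indicator of [m1] the other factor is [phi 0 = 1]. *)
rewrite p0 (_ : (fun _ => _ * _)%R = (fun m => (`[< m = m1 >])%:R%R)); last first.
  apply/funext => m; case: asboolP => [->|_]; last by rewrite mulr0.
  by rewrite p1 /phi big_ord0 mul1r.
rewrite (ops_delta _ _ _ false) (ops_delta _ _ _ true) phi_sum => E.
rewrite !big_map; refine (etrans _ E); rewrite big_allpairs big_enum /= big_distrl /=.
apply: eq_bigr => a _; rewrite big_distrr /=; apply: eq_bigr => e _.
by rewrite /mono /= !exprD; ring.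
Qed.

End Cell.

Lemma npart_const b n k (m : int -> bool) :
  (forall d : int, (k - n%:Z <= d < k)%R -> m d = b) -> npart n k m = b * n.
Proof.
move=> h; rewrite /npart (eq_big_nat _ _ (F2 := fun _ => nat_of_bool b)).
  by rewrite sum_nat_const_nat subn1 mulnC.
by move=> i hi; rewrite h //; lia.
Qed.

Lemma mem_moves2 r b ks (m m' : int -> bool) e : (e \in moves2 r b ks m m') =
  [&& e.1 \in sublists ks, e.2 \in sublists ks, valid r b e.1 m,
      valid r (~~ b) e.2 (run r e.1 m) & `[< run r e.2 (run r e.1 m) = m' >]].
Proof.
rewrite mem_filter andbC [RHS]andbA; congr (_ && _ ).
  apply/allpairsP/idP => [[[U V] /= [h1 h2 ->]]|/andP[h1 h2]].
    by rewrite h1.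
  by exists e; split=> //; case: (e).
Qed.

Section CellBijection.
Variable r : nat.
Hypothesis r_gt0 : 0 < r.

Lemma moves2_uniq b ks (m m' : int -> bool) : uniq ks -> uniq (moves2 r b ks m m').
Proof.
move=> u; apply: filter_uniq; apply: allpairs_uniq; rewrite ?sublists_uniq //.
by move=> [U V] [U' V'] _ _ [-> ->].
Qed.

Lemma cell_bijection (mu nu : intpart) :
  exists g : intpart * r.-tuple bool -> intpart,
    set_bij [set p | hstrip r p.1 mu /\ vstrip r p.1 nu]
            [set la | hstrip r nu la /\ vstrip r mu la] g /\
    forall p, hstrip r p.1 mu -> vstrip r p.1 nu ->
      [/\ size (hstd r nu (g p)) = size (hstd r p.1 mu) + weight p.2,
          size (vstd r mu (g p)) = size (vstd r p.1 nu) + weight p.2 &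
          hht r nu (g p) + vht r mu (g p) =
            hht r p.1 mu + vht r p.1 nu + 2 * nstat p.2].
Proof.
have [N0 [lo0 hi0]] := maya_bounds nu; have [N1 [lo1 hi1]] := maya_bounds mu.
(* Both diagrams are filled below [- N] and empty from [N] on, so all heads lie in the [N + N + r]
   positions from [- N] to below [N + r]. *)
pose N := maxn N0 N1; pose lo := (- N%:Z)%R; pose n := N + N + r.
have {}lo0 (d : int) : (d < lo)%R -> maya nu d by move=> ?; apply: lo0; lia.
have {}lo1 (d : int) : (d < lo)%R -> maya mu d by move=> ?; apply: lo1; lia.
have {}hi0 (d : int) : (N%:Z <= d)%R -> ~~ maya nu d by move=> ?; apply: hi0; lia.
have {}hi1 (d : int) : (N%:Z <= d)%R -> ~~ maya mu d by move=> ?; apply: hi1; lia.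
have nE : (N%:Z + r%:Z = lo + n%:Z)%R by rewrite /lo /n; lia.
have c0 : npart r lo (maya nu) = r.
  by rewrite (npart_const (b := true)) ?mul1n // => d hd; apply: lo0; lia.
have c1 : npart r (lo + n%:Z)%R (maya mu) = 0.
  by rewrite (npart_const (b := false)) ?mul0n // => d hd; apply/negbTE/hi1; lia.
have pe := perm_eq_of_mono (fun R x y s => cell_sum r_gt0 x y s c0 c1).
have uw : uniq (window lo n) by apply: (sorted_uniq lt_trans ltxx); apply: window_sorted.
have mem1 e : e \in moves2 r false (window lo n) (maya nu) (maya mu) <->
    [/\ sorted <%R e.1, sorted <%R e.2, valid r false e.1 (maya nu),
        valid r true e.2 (run r e.1 (maya nu)) &
        run r e.2 (run r e.1 (maya nu)) = maya mu].
  rewrite mem_moves2 !mem_sublists_window; split.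
    by case/and5P=> /andP[? _] /andP[? _] ? ? /asboolP.
  move=> [h1 h2 h3 h4 h5]; rewrite h1 h2 h3 h4 -nE.
  have /andP[-> ->] := downup_bounds r_gt0 lo0 hi0 lo1 hi1 h1 h2 h3 h4 h5.
  by apply/asboolP.
have mem2 e : e \in moves2 r true (window lo n) (maya nu) (maya mu) <->
    [/\ sorted <%R e.1, sorted <%R e.2, valid r true e.1 (maya nu),
        valid r false e.2 (run r e.1 (maya nu)) &
        run r e.2 (run r e.1 (maya nu)) = maya mu].
  rewrite mem_moves2 !mem_sublists_window; split.
    by case/and5P=> /andP[? _] /andP[? _] ? ? /asboolP.
  move=> [h1 h2 h3 h4 h5]; rewrite h1 h2 h3 h4 -nE.
  have /andP[-> ->] := updown_bounds r_gt0 lo0 hi1 h1 h2 h3 h4 h5.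
  by apply/asboolP.
(* Both codes describe routes from [maya nu] to [maya mu]: down then up through [p.1], or up then
   down through [la]. *)
pose e1 (p : intpart * r.-tuple bool) :=
  (p.2, (vheads r p.1 nu, hheads r p.1 mu)).
pose e2 la := (hheads r nu la, vheads r mu la).
have [||||||||g [bg wg]] := @bij_of_perm _ _ _ _ _
    [set p : intpart * r.-tuple bool | hstrip r p.1 mu /\ vstrip r p.1 nu]%classic
    [set la | hstrip r nu la /\ vstrip r mu la]%classic e1 e2 _ _ _ _ nu _ _ pe.
- apply: allpairs_uniq; rewrite ?enum_uniq ?moves2_uniq //.
  by move=> [a e] [a' e'] _ _ [-> -> ].
- exact: moves2_uniq.
- move=> [ka a] /= [hH hV]; apply/allpairsP; exists (a, (vheads r ka nu, hheads r ka mu)).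
  split; rewrite ?mem_enum //; apply/mem1 => /=.
  have [h1 h2 h3 _] := hstd_spec r_gt0 hH; have [v1 v2 v3 _] := vstd_spec r_gt0 hV.
  by rewrite v3.
- move=> [ka a] [ka' a'] /set_mem /= [hH hV] /set_mem /= [hH' hV'] [-> E _].
  have [_ _ v3 _] := vstd_spec r_gt0 hV; have [_ _ v3' _] := vstd_spec r_gt0 hV'.
  by congr (_, _); apply: maya_inj; rewrite -v3 E v3'.
- move=> _ /allpairsP[[a [D U]] /= [_ /mem1 /= [h1 h2 h3 h4 h5] ->]].
  have [ka kaE] := valid_false_end r_gt0 h3.
  rewrite -kaE in h4 h5.
  have [hV hVE] := vheads_unique r_gt0 h1 h3 (esym kaE).
  have [hH hHE] := hheads_unique r_gt0 h2 h4 h5.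
  by exists (ka, a) => //; rewrite /e1 /= hVE hHE.
- move=> la /= [hH hV]; apply/mem2 => /=.
  have [h1 h2 h3 _] := hstd_spec r_gt0 hH; have [v1 v2 v3 _] := vstd_spec r_gt0 hV.
  by rewrite h3.
- move=> la la' /set_mem /= [hH hV] /set_mem /= [hH' hV'] [E _].
  have [_ _ h3 _] := hstd_spec r_gt0 hH; have [_ _ h3' _] := hstd_spec r_gt0 hH'.
  by apply: maya_inj; rewrite -h3 E h3'.
- move=> [U D] /mem2 /= [h1 h2 h3 h4 h5].
  have [la laE] := valid_true_end r_gt0 h3.
  rewrite -laE in h4 h5.
  have [hH hHE] := hheads_unique r_gt0 h1 h3 (esym laE).
  have [hV hVE] := vheads_unique r_gt0 h2 h4 h5.
  by exists la => //; rewrite /e2 hVE hHE.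
exists g; split=> // -[ka a] /= hH hV.
have [hH' hV'] : hstrip r nu (g (ka, a)) /\ vstrip r mu (g (ka, a)).
  by case: bg => /(_ (ka, a)) bg _ _; apply: bg.
have [_ _ h3 h4] := hstd_spec r_gt0 hH; have [_ _ v3 v4] := vstd_spec r_gt0 hV.
have [_ _ h3' h4'] := hstd_spec r_gt0 hH'; have [_ _ v3' v4'] := vstd_spec r_gt0 hV'.
have := wg (ka, a) (conj hH hV); rewrite /updown_weight /downup_weight /e1 /e2 /=.
rewrite h3' -h4' -v4' v3 -h4 -v4 /hheads /vheads !size_rev !size_pairmap.
by move=> -[-> -> ->]; rewrite [hht _ _ _ + _]addnC.
Qed.

End CellBijection.

(** * Growth diagrams *)

Lemma hstrip_refl r la : hstrip r la la.
Proof. by exists [::]. Qed.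

Lemma vstrip_refl r la : vstrip r la la.
Proof. by exists [::]. Qed.

(** The last ribbon of a nontrivial chain could be removed from the core. *)
Lemma core_standardisation (R : rel int) r (la ga : intpart) c :
  is_core r ga -> standardisation R r la ga c -> la = ga.
Proof.
move=> core []; case/lastP: c => [_ //|c mu]; rewrite rcons_path last_rcons.
by case/andP=> _ /asboolP rib muE; case: (core (last la c)); rewrite -muE.
Qed.

Section Growth.
Variables (r : nat) (ga : intpart).
Hypotheses (r_gt0 : 0 < r) (ga_core : is_core r ga).

(* The local rule sends the two corners [(mu, nu)] and the pair of the third
   corner and the matrix entry to the fourth corner. *)
Variable g : intpart * intpart -> intpart * r.-tuple bool -> intpart.
Hypothesis g_bij : forall mu nu,
  set_bij [set p | hstrip r p.1 mu /\ vstrip r p.1 nu]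
          [set la | hstrip r nu la /\ vstrip r mu la] (g (mu, nu)).

Implicit Type A : nat -> nat -> r.-tuple bool.

Fixpoint growth_row (R : nat -> intpart) (a : nat -> r.-tuple bool) j : intpart :=
  if j is j'.+1 then g (R j'.+1, growth_row R a j') (R j', a j') else ga.

Fixpoint growth A i : nat -> intpart :=
  if i is i'.+1 then growth_row (growth A i') (A i') else fun _ => ga.

Lemma growth_0r A i : growth A i 0 = ga.
Proof. by case: i. Qed.

Lemma growth_SS A i j : growth A i.+1 j.+1 =
  g (growth A i j.+1, growth A i.+1 j) (growth A i j, A i j).
Proof. by []. Qed.

Lemma growth_strips A i j :
  hstrip r (growth A i j) (growth A i j.+1) /\
  vstrip r (growth A i j) (growth A i.+1 j).
Proof.
have V k : (forall l, hstrip r (growth A k l) (growth A k l.+1)) ->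
    forall l, vstrip r (growth A k l) (growth A k.+1 l) /\
      hstrip r (growth A k.+1 l) (growth A k.+1 l.+1).
  move=> H; have cell l : vstrip r (growth A k l) (growth A k.+1 l) ->
      hstrip r (growth A k.+1 l) (growth A k.+1 l.+1) /\
      vstrip r (growth A k l.+1) (growth A k.+1 l.+1).
    move=> Vl; have [gB _ _] := g_bij (growth A k l.+1) (growth A k.+1 l).
    exact: gB (growth A k l, A k l) (conj (H l) Vl).
  have Vk l : vstrip r (growth A k l) (growth A k.+1 l).
    by elim: l => [|l /cell[]//]; rewrite !growth_0r; apply: vstrip_refl.
  by move=> l; split=> //; have [] := cell l (Vk l).
suff H k l : hstrip r (growth A k l) (growth A k l.+1).
  by split=> //; have [] := V i (H i) j.
elim: k l => [|k IH] l; first exact: hstrip_refl.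
by have [] := V k IH l.
Qed.

Lemma eq_growth m n A A' : (forall i j, i < m -> j < n -> A i j = A' i j) ->
  forall i j, i <= m -> j <= n -> growth A i j = growth A' i j.
Proof.
move=> E; elim=> [|i IHi] // j im; elim: j => [|j IHj] // jn.
by rewrite !growth_SS !IHi ?IHj ?E // ltnW.
Qed.

(** The diagram is run backwards from its last row and column: cell by cell, leftwards and then
    upwards, injectivity of the local rule recovers the upper left corner and the entry. *)
Lemma growth_inj m n A A' :
  (forall j, j <= n -> growth A m j = growth A' m j) ->
  (forall i, i <= m -> growth A i n = growth A' i n) ->
  forall i j, i < m -> j < n -> A i j = A' i j.
Proof.
have row i k : (forall j, j <= k -> growth A i.+1 j = growth A' i.+1 j) ->
    growth A i k = growth A' i k ->
    (forall j, j < k -> A i j = A' i j) /\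
    (forall j, j <= k -> growth A i j = growth A' i j).
  elim: k => [|k IH] E1 E2; first by split=> // j; rewrite leqn0 => /eqP ->.
  have /pair_equal_spec[E3 E4] : (growth A i k, A i k) = (growth A' i k, A' i k).
    have [_ ginj _] := g_bij (growth A i k.+1) (growth A i.+1 k).
    have h1 := growth_strips A i k; have := growth_strips A' i k.
    rewrite -E2 -E1 ?leqnSn // => h2.
    apply: ginj; rewrite ?inE; [exact: h1 | exact: h2 |].
    by rewrite -growth_SS E1 // growth_SS -E2 -E1.
  have [|F1 F2] := IH _ E3; first by move=> j jk; apply: E1; apply: ltnW.
  split=> j; first by rewrite ltnS leq_eqVlt => /orP[/eqP->|/F1].
  by rewrite leq_eqVlt => /orP[/eqP->|/F2].
elim: m => [|m IH] // Em En i j im jn.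
have [F1 F2] := row m n Em (En _ (leqnSn m)).
move: im; rewrite ltnS leq_eqVlt => /orP[/eqP->|im]; first exact: F1.
by apply: IH => // i' im'; apply: En; apply: leqW.
Qed.

(** Surjectivity of the local rule, applied from right to left, builds the row above [R'] ending in
    [q], together with the matrix row between them. *)
Lemma growth_row_surj n (R' : nat -> intpart) q :
  (forall j, j < n -> hstrip r (R' j) (R' j.+1)) -> vstrip r q (R' n) ->
  exists R a, [/\ R n = q, forall j, j < n -> hstrip r (R j) (R j.+1),
    vstrip r (R 0) (R' 0) &
    forall j, j < n -> R' j.+1 = g (R j.+1, R' j) (R j, a j)].
Proof.
elim: n q => [|n IH] q HR Vq.
  by exists (fun _ => q), (fun _ => [tuple of nseq r false]).
have [_ _ gS] := g_bij q (R' n).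
have [[ka a0] /= [hH hV] gE] := gS _ (conj (HR n (leqnn _)) Vq).
have [R [a [Rn HRn V0 ER]]] := IH ka (fun j jn => HR j (ltnW jn)) hV.
exists (fun j => if j <= n then R j else q), (fun j => if j < n then a j else a0).
rewrite ltnn; split=> // j; rewrite ltnS => jn.
  rewrite jn; case: ltnP => [/HRn//|nj].
  by rewrite (_ : j = n) ?Rn //; apply/eqP; rewrite eqn_leq jn.
rewrite jn; case: ltnP => [/ER//|nj].
have -> : j = n by apply/eqP; rewrite eqn_leq jn.
by rewrite Rn -gE.
Qed.

Lemma growth_surj m n (P Q : nat -> intpart) :
  P 0 = ga -> Q 0 = ga -> P n = Q m ->
  (forall j, j < n -> hstrip r (P j) (P j.+1)) ->
  (forall i, i < m -> vstrip r (Q i) (Q i.+1)) ->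
  exists A, (forall j, j <= n -> growth A m j = P j) /\
            (forall i, i <= m -> growth A i n = Q i).
Proof.
elim: m P => [|m IH] P P0 Q0 PQ HP VQ.
  exists (fun _ _ => [tuple of nseq r false]); split=> [j jn|i]; last by rewrite leqn0 => /eqP ->.
  (* With no matrix row left, [P] ends at the core, so every strip in it is trivial and [P] is the
     constant top border. *)
  have : P n = ga by rewrite PQ.
  elim: n HP jn {PQ} => [|n IHn] HP jn Pn.
    by move: jn; rewrite leqn0 => /eqP ->.
  move: jn; rewrite leq_eqVlt => /orP[/eqP->//|]; rewrite ltnS => jn.
  apply: IHn => //; first by move=> j' h; apply: HP; apply: ltnW.
  by have [c] := HP n (leqnn _); rewrite Pn => /(core_standardisation ga_core).
have [|R [a [Rn HR V0 ER]]] := growth_row_surj (q := Q m) HP.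
  by rewrite PQ; apply: VQ.
(* The left border is forced too: a vertical strip ending at the core is trivial. *)
have R0 : R 0 = ga by case: V0 => c; rewrite P0 => /(core_standardisation ga_core).
have [|A [Am An]] := IH R R0 Q0 Rn HR; first by move=> i im; apply: VQ; apply: ltnW.
pose A1 i := if i < m then A i else a.
have E i j : i <= m -> j <= n -> growth A1 i j = growth A i j.
  by apply: eq_growth => i' j' im _; rewrite /A1 im.
have Em j : j <= n -> growth A1 m.+1 j = P j.
  elim: j => [|j IHj] jn; first by rewrite P0.
  have jn' := ltnW jn; have A1m : A1 m = a by rewrite /A1 ltnn.
  by rewrite growth_SS (IHj jn') (E m j) // (E m j.+1) // (Am _ jn) (Am _ jn') ER // A1m.
exists A1; split=> // i; rewrite leq_eqVlt => /orP[/eqP->|im]; first by rewrite Em.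
by rewrite E // An.
Qed.

Hypothesis g_weight : forall mu nu p, hstrip r p.1 mu -> vstrip r p.1 nu ->
  [/\ size (hstd r nu (g (mu, nu) p)) = size (hstd r p.1 mu) + weight p.2,
      size (vstd r mu (g (mu, nu) p)) = size (vstd r p.1 nu) + weight p.2 &
      hht r nu (g (mu, nu) p) + vht r mu (g (mu, nu) p) =
        hht r p.1 mu + vht r p.1 nu + 2 * nstat p.2].

Lemma hstd_refl la : hstd r la la = [::].
Proof.
have [_] := hheads_unique r_gt0 (S := [::]) (la := la) (mu := la) isT isT erefl.
by move/(congr1 size); rewrite size_pairmap => /size0nil.
Qed.

Lemma vstd_refl la : vstd r la la = [::].
Proof.
have [_] := vheads_unique r_gt0 (S := [::]) (la := la) (mu := la) isT isT erefl.
by move/(congr1 size); rewrite size_rev size_pairmap => /size0nil.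
Qed.

Lemma size_hstd_growth A m j :
  size (hstd r (growth A m j) (growth A m j.+1)) = \sum_(i < m) weight (A i j).
Proof.
elim: m => [|m IH]; first by rewrite hstd_refl big_ord0.
have [hH hV] := growth_strips A m j.
by have [E _ _] := g_weight (p := (_, A m j)) hH hV; rewrite big_ord_recr -IH; exact: E.
Qed.

Lemma size_vstd_growth A i n :
  size (vstd r (growth A i n) (growth A i.+1 n)) = \sum_(j < n) weight (A i j).
Proof.
elim: n => [|n IH]; first by rewrite !growth_0r vstd_refl big_ord0.
have [hH hV] := growth_strips A i n.
by have [_ E _] := g_weight (p := (_, A i n)) hH hV; rewrite big_ord_recr -IH; exact: E.
Qed.

(** Summing the local height identity along a row cancels the inner vertical strips; summing over
    the rows then cancels the inner horizontal ones. The strips on the constant border have height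
    0. *)
Lemma heights_growth A m n :
  \sum_(j < n) hht r (growth A m j) (growth A m j.+1) +
  \sum_(i < m) vht r (growth A i n) (growth A i.+1 n) =
  2 * \sum_(i < m) \sum_(j < n) nstat (A i j).
Proof.
have row i k : \sum_(j < k) hht r (growth A i.+1 j) (growth A i.+1 j.+1) +
    vht r (growth A i k) (growth A i.+1 k) =
    \sum_(j < k) hht r (growth A i j) (growth A i j.+1) +
    2 * \sum_(j < k) nstat (A i j).
  elim: k => [|k IH]; first by rewrite !big_ord0 !growth_0r /vht vstd_refl.
  have [hH hV] := growth_strips A i k.
  have [_ _ E] := g_weight (p := (_, A i k)) hH hV.
  by rewrite !big_ord_recr; move: IH E => /=; lia.
elim: m => [|m IH].
  rewrite !big_ord0 big1 // => j _.
  by rewrite /hht hstd_refl.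
by rewrite !big_ord_recr mulnDr -IH; have := row m n => /=; lia.
Qed.

End Growth.

(** * The correspondence between matrices and pairs of tableaux *)

Theorem corollary6p4 (r : nat) (r_gt0 : 0 < r) (ga : intpart)
    (ga_core : is_core r ga) (m n : nat) :
  exists f : 'M[r.-tuple bool]_(m, n) ->
             n.+1.-tuple intpart * m.+1.-tuple intpart,
    set_bij [set: 'M[r.-tuple bool]_(m, n)] (tableau_pairs r ga m n) f /\
    forall A : 'M[r.-tuple bool]_(m, n),
      [/\ wt r (f A).1 = [tuple \sum_(i < m) weight (A i j) | j < n],
          wtt r (f A).2 = [tuple \sum_(j < n) weight (A i j) | i < m] &
          (spin r (f A).1 + spint r (f A).2)%R =
            ((\sum_(i < m) \sum_(j < n) nstat (A i j))%:R : rat)%R].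
Proof.
have [g gP] := choice (fun mn : intpart * intpart => cell_bijection r_gt0 mn.1 mn.2).
have g_bij mu nu := (gP (mu, nu)).1; have g_weight mu nu := (gP (mu, nu)).2.
(* Growth diagrams take entries at all natural indices; outside the matrix the zero vector is used,
   and by [eq_growth] the corners up to [(m, n)] depend only on the entries inside. *)
pose ext (A : 'M[r.-tuple bool]_(m, n)) (i j : nat) : r.-tuple bool :=
  if (insub i, insub j) is (Some i', Some j') then A i' j' else [tuple of nseq r false].
have extE A (i : 'I_m) (j : 'I_n) : ext A i j = A i j by rewrite /ext !valK.
pose L A := growth ga g (ext A).
pose f A := ([tuple L A m j | j < n.+1], [tuple L A i n | i < m.+1]).
have lo1 A (j : 'I_n) : lower (f A).1 j = L A m j by rewrite /lower tnth_mktuple.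
have up1 A (j : 'I_n) : upper (f A).1 j = L A m j.+1 by rewrite /upper tnth_mktuple.
have lo2 A (i : 'I_m) : lower (f A).2 i = L A i n by rewrite /lower tnth_mktuple.
have up2 A (i : 'I_m) : upper (f A).2 i = L A i.+1 n by rewrite /upper tnth_mktuple.
have strips A := growth_strips ga g_bij (ext A).
exists f; split; last first.
  move=> A; split.
  - apply: eq_from_tnth => j; rewrite !tnth_mktuple lo1 up1.
    rewrite (size_hstd_growth ga r_gt0 g_bij g_weight).
    by apply: eq_bigr => i _; rewrite extE.
  - apply: eq_from_tnth => i; rewrite !tnth_mktuple lo2 up2.
    rewrite (size_vstd_growth ga r_gt0 g_bij g_weight).
    by apply: eq_bigr => j _; rewrite extE.
  have := heights_growth ga r_gt0 g_bij g_weight (ext A) m n => E.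
  (* Spins are half sums of heights, so the right side is written as [2^-1 * (2 * _)] to match
     [heights_growth]. *)
  rewrite /spin /spint -[RHS](mulKf (_ : 2%:R != 0 :> rat)%R) // -natrM.
  under eq_bigr do rewrite lo1 up1.
  under [X in (_ + X)%R]eq_bigr do rewrite lo2 up2.
  rewrite -!mulr_suml -mulrDl -!natr_sum -natrD mulrC; congr (_ * _%:R)%R.
  rewrite E; congr (_ * _); apply: eq_bigr => i _; apply: eq_bigr => j _.
  by rewrite extE.
split.
- move=> A _; exists (L A m n); split; split.
  + by rewrite tnth_mktuple /L growth_0r.
  + by rewrite tnth_mktuple.
  + by move=> j; rewrite lo1 up1; apply: (strips A m j).1.
  + by rewrite tnth_mktuple.
  + by rewrite tnth_mktuple.
  + by move=> i; rewrite lo2 up2; apply: (strips A i n).2.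
- move=> A A' _ _ /pair_equal_spec[E1 E2]; apply/matrixP => i j; rewrite -!extE.
  apply: (growth_inj g_bij (m := m) (n := n)) => // k hk.
    by have := congr1 (fun T => tnth T (Ordinal (hk : k < n.+1))) E1; rewrite !tnth_mktuple; apply.
  by have := congr1 (fun T => tnth T (Ordinal (hk : k < m.+1))) E2; rewrite !tnth_mktuple; apply.
move=> [P Q] [la [[/= P0 Pn HP] [/= Q0 Qm VQ]]].
have [|||||A [Am An]] := @growth_surj r ga ga_core g g_bij m n (nth ga P) (nth ga Q).
- by rewrite -[RHS]P0 (tnth_nth ga).
- by rewrite -[RHS]Q0 (tnth_nth ga).
- by rewrite -(tnth_nth ga P ord_max) -(tnth_nth ga Q ord_max) Pn Qm.
- by move=> j jn; have := HP (Ordinal jn); rewrite /lower /upper !(tnth_nth ga).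
- by move=> i im; have := VQ (Ordinal im); rewrite /lower /upper !(tnth_nth ga).
exists (\matrix_(i, j) A i j)%R => //.
have E i j : i <= m -> j <= n -> L (\matrix_(i, j) A i j)%R i j = growth ga g A i j.
  apply: eq_growth => i' j' im jn.
  by rewrite -[i']/(val (Ordinal im)) -[j']/(val (Ordinal jn)) extE mxE.
have le_ord p (k : 'I_p.+1) : k <= p by rewrite -ltnS.
congr (_, _); apply: eq_from_tnth => k; rewrite tnth_mktuple E ?le_ord //.
  by rewrite Am ?le_ord // (tnth_nth ga).
by rewrite An ?le_ord // (tnth_nth ga).
Qed.
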